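(* Let $\mathcal{H}$ be a separable infinite-dimensional Hilbert space, let $S\in L(\mathcal{H})$ be a bounded selfadjoint operator, and let $\mathbf{c}=(c_n)_{n\in\mathbb{N}}$ be a bounded sequence of real numbers. Then the following conditions are equivalent: 1. $\mathbf{c}\in\overline{\mathcal{C}[\mathcal{U}_{\mathcal{H}}(S)]}$, where the closure is taken in $\ell^\infty(\mathbb{N})$ with respect to $\|\cdot\|_\infty$. 2. $U_k(S)\ge U_k(\mathbf{c})$ and $L_k(S)\le L_k(\mathbf{c})$ for every $k\in\mathbb{N}$. If this is the case, then $\max\sigma_e(S)\ge\limsup\mathbf{c}$ and $\min\sigma_e(S)\le\liminf\mathbf{c}$.
   Context: Hilbert spaces are complex. $L(\mathcal{H})$ is the algebra of bounded linear operators on $\mathcal{H}$; $\mathbb{N}=\{1,2,\dots\}$. For selfadjoint $S$ and $k\in\mathbb{N}$, let $\mathcal{P}_k$ be the set of orthogonal projections onto $k$-dimensional subspaces of $\mathcal{H}$, and put $U_k(S)=\sup_{P\in\mathcal{P}_k}\operatorname{tr}(SP)$, $L_k(S)=\inf_{P\in\mathcal{P}_k}\operatorname{tr}(SP)$. For a bounded real sequence $\mathbf{c}$, $U_k(\mathbf{c})=\sup_{|F|=k}\sum_{i\in F}c_i$ and $L_k(\mathbf{c})=\inf_{|F|=k}\sum_{i\in F}c_i$, over subsets $F\subset\mathbb{N}$ with exactly $k$ elements. $\mathcal{U}_{\mathcal{H}}(S)=\{U^*SU: U \text{ unitary on }\mathcal{H}\}$. $\mathcal{C}[\mathcal{U}_{\mathcal{H}}(S)]$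 is the set of sequences $(\langle Te_n,e_n\rangle)_{n\in\mathbb{N}}$ with $T\in\mathcal{U}_{\mathcal{H}}(S)$, where $\{e_n\}_{n\in\mathbb{N}}$ is a fixed orthonormal basis of $\mathcal{H}$ (the set does not depend on the choice of basis); equivalently, it is the set of all sequences $(\langle Se_n,e_n\rangle)_{n\in\mathbb{N}}$ as $\{e_n\}_{n\in\mathbb{N}}$ ranges over the orthonormal bases of $\mathcal{H}$. $\sigma_e(S)$ is the essential spectrum of $S$, i.e. the spectrum of the class of $S$ in the Calkin algebra $L(\mathcal{H})/L_0(\mathcal{H})$, where $L_0(\mathcal{H})$ is the ideal of compact operators. *)

(* Defs.v *)
From HB Require Import structures.
From mathcomp Require Import all_boot all_order all_algebra.
From mathcomp Require Import finmap complex.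
From mathcomp Require Import all_classical all_reals all_analysis.

Set Implicit Arguments.
Unset Strict Implicit.
Unset Printing Implicit Defensive.

Import Order.TTheory GRing.Theory Num.Theory.
Import numFieldNormedType.Exports.

Local Open Scope classical_set_scope.
Local Open Scope complex_scope.
Local Open Scope ring_scope.

(* The field of complex numbers is R[i] with R : realType.  A Hilbert space is a
   complete normed module H over R[i] with an inner product
   dot : {dot H for Num.conj} (linear in the first argument, conjugate-linear
   in the second, positive definite) that induces the norm (hilbert_norm).      *)

Definition hilbert_norm (R : realType) (H : completeNormedModType R[i])
    (dot : {dot H for Num.conj}) : Prop :=
  forall x : H, `|x| ^+ 2 = dot x x.

Definition separable_space (T : topologicalType) : Prop :=
  exists D : set T, countable D /\ dense D.

Section Operators.
Context {R : realType} {H : completeNormedModType R[i]}.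
Implicit Types (S T : H -> H) (k : nat) (e : nat -> H).

Definition lin_indep k (v : 'I_k -> H) : Prop :=
  forall a : 'I_k -> R[i], \sum_(i < k) a i *: v i = 0 -> forall i, a i = 0.

Definition span k (v : 'I_k -> H) : set H :=
  [set \sum_(i < k) a i *: v i | a in [set: 'I_k -> R[i]]].

Definition has_dim (V : set H) k : Prop :=
  exists v : 'I_k -> H, lin_indep v /\ V = span v.

Definition infinite_dim : Prop := forall k, ~ has_dim [set: H] k.

Definition bounded_op S : Prop :=
  exists M : R, forall x, `|S x| <= M%:C * `|x|.

Definition compact_op S : Prop :=
  precompact (S @` [set x | `|x| <= 1]).

(* The Calkin algebra is represented by operators up to compact perturbations:
   calkin_eq S T says that S and T have the same class, and calkin_unit S that
   the class of S is invertible.                                                *)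
Definition calkin_eq S T : Prop := compact_op (S \- T).

Definition calkin_unit S : Prop :=
  exists T : {linear H -> H},
    [/\ bounded_op T, calkin_eq (S \o T) id & calkin_eq (T \o S) id].

Definition ess_spectrum S : set R[i] :=
  [set l | ~ calkin_unit (S \- l \*: id)].

Variable dot : {dot H for Num.conj}.

Definition is_adjoint S T : Prop := forall x y, dot (S x) y = dot x (T y).

Definition selfadjoint S : Prop := is_adjoint S S.

Definition orthonormal_basis e : Prop :=
  (forall i j, dot (e i) (e j) = (i == j)%:R) /\
  dense (\bigcup_k span (fun i : 'I_k => e i)).

(* The trace, required to exist with the same value in every orthonormal basis;
   this is always the case for operators of finite rank.                        *)
Definition is_trace T (t : R[i]) : Prop :=
  forall e, orthonormal_basis e ->
    series (fun n => dot (T (e n)) (e n) : R[i]^o) @ \oo --> (t : R[i]^o).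

Definition orth_proj k (P : {linear H -> H}) : Prop :=
  [/\ bounded_op P, P \o P = P, selfadjoint P & has_dim (range P) k].

Definition proj_traces S k : set R :=
  [set t | exists P : {linear H -> H}, orth_proj k P /\ is_trace (S \o P) t%:C].

Definition U_op k S : R := sup (proj_traces S k).
Definition L_op k S : R := inf (proj_traces S k).

(* W is the adjoint U^* of U. *)
Definition unitary_with_adjoint (U W : {linear H -> H}) : Prop :=
  [/\ bounded_op U, bounded_op W, is_adjoint U W, W \o U = id & U \o W = id].

Definition unitary_orbit S : set (H -> H) :=
  [set T | exists U W : {linear H -> H},
             unitary_with_adjoint U W /\ T = W \o S \o U].

(* Sequences are indexed from 0.  The diagonal entries of selfadjoint operators
   are real, so the diagonals are taken as real sequences.                      *)
Definition orbit_diagonals e S : set (nat -> R) :=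
  [set d | exists T, unitary_orbit S T /\
             forall n, (d n)%:C = dot (T (e n)) (e n)].

End Operators.

Section Sequences.
Context {R : realType}.
Implicit Types (c d : nat -> R) (k : nat).

Definition subset_sums k c : set R :=
  [set s | exists F : {fset nat}, #|` F|%fset = k /\ s = \sum_(i <- F) c i].

Definition U_seq k c : R := sup (subset_sums k c).
Definition L_seq k c : R := inf (subset_sums k c).

Definition linfty_norm c : \bar R := ereal_sup (range (fun n => `|c n|%:E)).

Definition linfty : set (nat -> R) := [set c | (linfty_norm c < +oo)%E].

Definition linfty_closure (A : set (nat -> R)) : set (nat -> R) :=
  [set c | linfty c /\ forall eps : R, 0 < eps ->
     exists d, [/\ A d, linfty d & (linfty_norm (c \- d)%R < eps%:E)%E]].

End Sequences.

(* For l and m in R[i], l <= m means that m - l is a nonnegative real. *)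
Definition is_max (R : realType) (A : set R[i]) (M : R) : Prop :=
  A M%:C /\ forall l, A l -> l <= M%:C.

Definition is_min (R : realType) (A : set R[i]) (m : R) : Prop :=
  A m%:C /\ forall l, A l -> m%:C <= l.

(* Main.v *)
Require Import Defs.
From HB Require Import structures.
From mathcomp Require Import all_boot all_order all_algebra.
From mathcomp Require Import finmap complex.
From mathcomp Require Import all_classical all_reals all_analysis.
From mathcomp Require Import ring lra zify.
Set Implicit Arguments.
Unset Strict Implicit.
Unset Printing Implicit Defensive.
Import Order.TTheory GRing.Theory Num.Theory.
Import numFieldNormedType.Exports.
Local Open Scope classical_set_scope.
Local Open Scope complex_scope.
Local Open Scope ring_scope.

(** The two steps meet different obstacles. An entry of c beyond the essential bounds may be out of
    reach of vectors taken from deep in the space, so it has to come from an almost extremal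
    finite-dimensional compression. That compression attains the sums only up to eps and has more
    eigenvalues than there are entries; hence Schur-Horn appears with two one-sided conditions in
    place of a trace equality. For the remaining entries suitable vectors always exist, but a
    sequence chosen only for its diagonal entries need not be complete, and a diagonal of the
    unitary orbit comes from a basis. The tilting angle is the same at all steps, so that the
    contraction factors multiply to 0; this is possible because tilting moves the n-th entry by at
    most a small multiple of s + |c_n|, where s bounds S, and c is bounded. Lower bounds are upper
    bounds for -S and -c. *)

(**
Let M be the largest number such that every subspace of finite codimension contains
unit vectors y with <Sy, y> arbitrarily close to M or above.  Modulo finite rank,
S <= M + eps; with the Cauchy-Schwarz inequality for the form of M + eps - S this
makes M the maximum of the essential spectrum.  Summing over orthonormal families
gives U_k(S) <= k (M + eps) + O(1), so the majorization leaves only finitely many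
terms of c above M + eps, and likewise below m - eps, where m is the minimum.

An orthonormal sequence (f_n) with <S f_n, f_n> close to c_n is then built in two
steps.  The finitely many first terms come from the finite-dimensional Schur-Horn
theorem applied to a compression of S that almost attains U_k(S) and L_k(S).  For
the other ones, c_n lies in the essential numerical range up to eps, so that there
are unit vectors y orthogonal to any given finite set with <Sy, y> close to c_n.
Tilting such a y by a fixed small angle towards the residual of a vector of the
given basis keeps the diagonal entry close to c_n and multiplies the residual by a
constant smaller than 1; as every basis vector is treated infinitely often, the
sequence obtained is a basis.
*)

Local Notation Re := complex.Re.
Local Notation Im := complex.Im.

Section ComplexNumbers.
Context {R : realType}.
Implicit Types (z w : R[i]) (a b : R).

Definition sqn z : R := Re z ^+ 2 + Im z ^+ 2.

Lemma sqnE z : z * z^*%C = (sqn z)%:C.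
Proof. by case: z => a b; rewrite /sqn; simpc; congr (_ +i* _); ring. Qed.
Lemma ReD z w : Re (z + w) = Re z + Re w. Proof. by case: z; case: w. Qed.
Lemma ReN z : Re (- z) = - Re z. Proof. by case: z. Qed.
Lemma ReB z w : Re (z - w) = Re z - Re w. Proof. by rewrite ReD ReN. Qed.
Lemma ReM z w : Re (z * w) = Re z * Re w - Im z * Im w. Proof. by case: z; case: w. Qed.
Lemma ReZ a z : Re (a%:C * z) = a * Re z. Proof. by rewrite ReM /= mul0r subr0. Qed.
Lemma Re_conj z : Re z^*%C = Re z. Proof. by case: z. Qed.
Lemma Im_conj z : Im z^*%C = - Im z. Proof. by case: z. Qed.
Lemma sqn_ge0 z : 0 <= sqn z. Proof. by rewrite addr_ge0 ?sqr_ge0. Qed.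
Lemma sqn_conj z : sqn z^*%C = sqn z. Proof. by rewrite /sqn Re_conj Im_conj sqrrN. Qed.
Lemma sqn0 : sqn 0 = 0. Proof. by rewrite /sqn /= !expr0n addr0. Qed.
Lemma sqnM z w : sqn (z * w) = sqn z * sqn w.
Proof. by case: z => a b; case: w => c d; rewrite /sqn; simpc => /=; ring. Qed.
Lemma sqn_real a : sqn a%:C = a ^+ 2. Proof. by rewrite /sqn /= expr0n addr0. Qed.
Lemma sqn_eq0 z : (sqn z == 0) = (z == 0).
Proof. by rewrite /sqn paddr_eq0 ?sqr_ge0// !sqrf_eq0 eq_complex. Qed.
Lemma Re_sum I (r : seq I) (P : pred I) (F : I -> R[i]) :
  Re (\sum_(i <- r | P i) F i) = \sum_(i <- r | P i) Re (F i).
Proof. by elim/big_ind2: _ => // *; rewrite ReD; congr (_ + _). Qed.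
Lemma RC_sum I (r : seq I) (P : pred I) (F : I -> R) :
  (\sum_(i <- r | P i) F i)%:C = \sum_(i <- r | P i) (F i)%:C.
Proof. exact: rmorph_sum. Qed.
Lemma RCM a b : (a * b)%:C = a%:C * b%:C. Proof. exact: rmorphM. Qed.
Lemma RCD a b : (a + b)%:C = a%:C + b%:C. Proof. exact: rmorphD. Qed.
Lemma RCN a : (- a)%:C = - a%:C. Proof. exact: rmorphN. Qed.
Lemma RCB a b : (a - b)%:C = a%:C - b%:C. Proof. exact: rmorphB. Qed.
End ComplexNumbers.

(** * Orthonormal families and Gram-Schmidt *)

Section InnerProduct.
Context {R : realType} {H : completeNormedModType R[i]}.
Variable dot : {dot H for Num.conj}.
Implicit Types (x y z : H) (u v w : nat -> H) (k D : nat).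

Lemma dotC x y : dot x y = (dot y x)^*%C.
Proof. by rewrite {1}hermC /= mul1r. Qed.
Lemma dotDl x y z : dot (x + y) z = dot x z + dot y z. Proof. exact: linearDl. Qed.
Lemma dotDr x y z : dot z (x + y) = dot z x + dot z y. Proof. exact: linearDr. Qed.
Lemma dotNl x z : dot (- x) z = - dot x z. Proof. exact: linearNl. Qed.
Lemma dotNr x z : dot z (- x) = - dot z x. Proof. exact: linearNr. Qed.
Lemma dotBl x y z : dot (x - y) z = dot x z - dot y z. Proof. exact: linearBl. Qed.
Lemma dotBr x y z : dot z (x - y) = dot z x - dot z y. Proof. exact: linearBr. Qed.
Lemma dotZl a x z : dot (a *: x) z = a * dot x z. Proof. exact: linearZl_LR. Qed.
Lemma dotZr a x z : dot z (a *: x) = a^*%C * dot z x. Proof. exact: linearZr_LR. Qed.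
Lemma dot0l z : dot 0 z = 0. Proof. exact: linear0l. Qed.
Lemma dot0r z : dot z 0 = 0. Proof. exact: linear0r. Qed.
Lemma dot_suml I (r : seq I) (P : pred I) (F : I -> H) z :
  dot (\sum_(i <- r | P i) F i) z = \sum_(i <- r | P i) dot (F i) z.
Proof. exact: linear_sumlz. Qed.
Lemma dot_sumr I (r : seq I) (P : pred I) (F : I -> H) z :
  dot z (\sum_(i <- r | P i) F i) = \sum_(i <- r | P i) dot z (F i).
Proof. exact: linear_sumr. Qed.
Definition dotE := (dotDl, dotDr, dotNl, dotNr, dotZl, dotZr, dot0l, dot0r).

(** The norm of [H] has values in [R[i]]; its square is handled in [R], so that estimates are real
    polynomial inequalities. *)
Definition sqnorm x : R := Re (dot x x).

Lemma dotxx x : dot x x = (sqnorm x)%:C.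
Proof.
rewrite /sqnorm; have := dnorm_ge0 dot x; case: (dot x x) => a b.
by rewrite lecE /= => /andP[/eqP -> _].
Qed.
Lemma sqnorm_ge0 x : 0 <= sqnorm x.
Proof. by have := dnorm_ge0 dot x; rewrite dotxx ler0c. Qed.
Lemma sqnorm_eq0 x : (sqnorm x == 0) = (x == 0).
Proof. by rewrite -(dnorm_eq0 dot x) dotxx -[0 in RHS]/((0:R)%:C) (inj_eq (@complexI R)). Qed.
Lemma sqnorm0 : sqnorm 0 = 0. Proof. by rewrite /sqnorm dot0l. Qed.
Lemma sqnormN x : sqnorm (- x) = sqnorm x. Proof. by rewrite /sqnorm dotNl dotNr opprK. Qed.
Lemma sqnormZ a x : sqnorm (a *: x) = sqn a * sqnorm x.
Proof. by apply: complexI; rewrite RCM -!dotxx dotZl dotZr mulrA sqnE. Qed.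
Lemma Re_dotC x y : Re (dot x y) = Re (dot y x).
Proof. by rewrite dotC Re_conj. Qed.
Lemma sqn_dotC x y : sqn (dot x y) = sqn (dot y x).
Proof. by rewrite dotC sqn_conj. Qed.
Lemma sqnormD x y : sqnorm (x + y) = sqnorm x + sqnorm y + 2 * Re (dot x y).
Proof. by rewrite /sqnorm !dotE !ReD (Re_dotC y x); ring. Qed.
Lemma sqnormB x y : sqnorm (x - y) = sqnorm x + sqnorm y - 2 * Re (dot x y).
Proof. by rewrite sqnormD sqnormN dotNr ReN; ring. Qed.

Lemma CauchySchwarz_sqn x y : sqn (dot x y) <= sqnorm x * sqnorm y.
Proof.
have [->|y0] := eqVneq y 0; first by rewrite dot0r sqn0 sqnorm0 mulr0.
have ny : 0 < sqnorm y by rewrite lt_neqAle sqnorm_ge0 eq_sym sqnorm_eq0 y0.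
have := sqnorm_ge0 ((sqnorm y)%:C *: x - dot x y *: y).
rewrite sqnormB !sqnormZ sqn_real dotZl dotZr.
rewrite (_ : (sqnorm y)%:C * ((dot x y)^*%C * dot x y) = (sqnorm y * sqn (dot x y))%:C); last first.
  by rewrite RCM -sqnE; ring.
rewrite /= => h; rewrite -(ler_pM2l ny); nra.
Qed.

(** Expand the square of d x - y. The weight d decides how a cross term is shared between the two
    vectors. *)
Lemma young x y (d : R) : 0 < d -> 2 * Re (dot x y) <= d * sqnorm x + d^-1 * sqnorm y.
Proof.
move=> d0; have := sqnorm_ge0 (d%:C *: x - y).
rewrite sqnormB sqnormZ sqn_real dotZl ReZ => h.
rewrite -(ler_pM2l d0) mulrDr !mulrA divff ?gt_eqF// mul1r; nra.
Qed.

Lemma sqnormD_le x y : sqnorm (x + y) <= 2 * sqnorm x + 2 * sqnorm y.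
Proof. have := sqnorm_ge0 (x - y); rewrite sqnormB sqnormD; lra. Qed.

(* Finite families are sequences of which only the first k terms count: this makes
   extending a family, and passing to an infinite one, free of casts. *)
Definition orthofam k u := forall i j, (i < k)%N -> (j < k)%N -> dot (u i) (u j) = (i == j)%:R.

Lemma orthofam_sqnorm k u i : orthofam k u -> (i < k)%N -> sqnorm (u i) = 1.
Proof. by move=> ou ik; rewrite /sqnorm ou// eqxx. Qed.
Lemma orthofamW k k' u : (k' <= k)%N -> orthofam k u -> orthofam k' u.
Proof. by move=> kk ou i j ik jk; apply: ou; apply: leq_trans kk. Qed.

Definition oproj k u x : H := \sum_(i < k) dot x (u i) *: u i.

Lemma oproj_dot k u x j : orthofam k u -> (j < k)%N -> dot (oproj k u x) (u j) = dot x (u j).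
Proof.
move=> ou jk; rewrite /oproj dot_suml (bigD1 (Ordinal jk)) //= dotZl ou// eqxx mulr1.
rewrite big1 ?addr0// => i /negbTE ij; rewrite dotZl ou// .
by rewrite -[X in (X == _)]/(val i) -[j in (_ == j)]/(val (Ordinal jk)) val_eqE ij mulr0.
Qed.
Lemma oproj_res k u x j : orthofam k u -> (j < k)%N -> dot (x - oproj k u x) (u j) = 0.
Proof. by move=> ou jk; rewrite dotBl oproj_dot// subrr. Qed.
Lemma dot_oproj k u x y : dot (oproj k u x) y = \sum_(i < k) dot x (u i) * dot (u i) y.
Proof. by rewrite dot_suml; under eq_bigr do rewrite dotZl. Qed.
Lemma dot_oprojr k u x y : dot y (oproj k u x) = \sum_(i < k) dot y (u i) * dot (u i) x.
Proof.
rewrite dot_sumr; apply: eq_bigr => i _.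
by rewrite dotZr [X in X * _](_ : _ = dot (u i) x) -?dotC// mulrC.
Qed.
Lemma oproj_selfadj k u x y : dot (oproj k u x) y = dot x (oproj k u y).
Proof. by rewrite dot_oproj dot_oprojr. Qed.
Lemma sqnorm_oproj k u x : orthofam k u -> sqnorm (oproj k u x) = \sum_(i < k) sqn (dot x (u i)).
Proof.
move=> ou; apply: complexI; rewrite -dotxx dot_oprojr RC_sum; apply: eq_bigr => i _.
by rewrite oproj_dot// (dotC (u i) x) sqnE.
Qed.
Lemma sqnorm_res k u x : orthofam k u ->
  sqnorm (x - oproj k u x) = sqnorm x - \sum_(i < k) sqn (dot x (u i)).
Proof.
move=> ou; rewrite sqnormB -sqnorm_oproj//.
have -> : Re (dot x (oproj k u x)) = sqnorm (oproj k u x).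
  rewrite sqnorm_oproj// dot_oprojr Re_sum; apply: eq_bigr => i _.
  by rewrite (dotC (u i) x) sqnE.
ring.
Qed.
Lemma bessel k u x : orthofam k u -> \sum_(i < k) sqn (dot x (u i)) <= sqnorm x.
Proof. by move=> ou; rewrite -subr_ge0 -sqnorm_res// sqnorm_ge0. Qed.
Lemma oprojD k u x y : oproj k u (x + y) = oproj k u x + oproj k u y.
Proof. by rewrite /oproj -big_split; apply: eq_bigr => i _; rewrite dotDl scalerDl. Qed.
Lemma oprojZ k u a x : oproj k u (a *: x) = a *: oproj k u x.
Proof. by rewrite /oproj scaler_sumr; apply: eq_bigr => i _; rewrite dotZl scalerA. Qed.
Lemma oprojN k u x : oproj k u (- x) = - oproj k u x.
Proof. by rewrite -scaleN1r oprojZ scaleN1r. Qed.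
Lemma oprojB k u x y : oproj k u (x - y) = oproj k u x - oproj k u y.
Proof. by rewrite oprojD oprojN. Qed.
Lemma oproj_id k u j : orthofam k u -> (j < k)%N -> oproj k u (u j) = u j.
Proof.
move=> ou jk; rewrite /oproj (bigD1 (Ordinal jk)) //= ou// eqxx scale1r.
rewrite big1 ?addr0// => i /negbTE ij; rewrite ou//.
by rewrite eq_sym -[X in (X == _)]/(val i) -[j in (_ == j)]/(val (Ordinal jk)) val_eqE ij scale0r.
Qed.
Lemma oproj_perp k u x y : (forall i, (i < k)%N -> dot y (u i) = 0) -> dot y (oproj k u x) = 0.
Proof. by move=> h; rewrite dot_oprojr big1// => i _; rewrite h// mul0r. Qed.
(** Here and below, [x = oproj D w x] encodes that x lies in the span of w. *)
Lemma oproj_comp k u w D x : orthofam D w -> (forall i, (i < k)%N -> u i = oproj D w (u i)) ->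
  oproj D w (oproj k u x) = oproj k u x.
Proof.
move=> ow h; rewrite {2 3}/oproj -(big_mkord xpredT (fun i => dot x (u i) *: u i)).
elim: k h => [|k IH] h; first by rewrite big_nil /oproj big1// => i _; rewrite dot0l scale0r.
rewrite big_nat_recr //= oprojD oprojZ -h// IH// => i ik; apply: h; exact: ltnW.
Qed.
Lemma oproj_idem k u x : orthofam k u -> oproj k u (oproj k u x) = oproj k u x.
Proof. by move=> ou; apply: oproj_comp => // i ik; rewrite oproj_id. Qed.
(** As the projection fixes y, the residual of x is also that of x - y, and taking residuals does
    not increase the norm. *)
Lemma res_le k u x y : orthofam k u -> y = oproj k u y ->
  sqnorm (x - oproj k u x) <= sqnorm (x - y).
Proof.
move=> ou yE; have -> : x - oproj k u x = (x - y) - oproj k u (x - y).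
  by rewrite oprojB -yE opprB addrA subrK.
by rewrite sqnorm_res// gerBl sumr_ge0// => i _; rewrite sqn_ge0.
Qed.

Definition extend k u x : nat -> H := fun i => if (i < k)%N then u i else x.

Lemma extend_lt k u x i : (i < k)%N -> extend k u x i = u i.
Proof. by rewrite /extend => ->. Qed.
Lemma extend_last k u x : extend k u x k = x.
Proof. by rewrite /extend ltnn. Qed.
Lemma orthofam_extend k u x : orthofam k u -> sqnorm x = 1 ->
  (forall i, (i < k)%N -> dot x (u i) = 0) ->
  orthofam k.+1 (extend k u x).
Proof.
move=> ou x1 xu i j; rewrite !ltnS leq_eqVlt => /predU1P[->|ik].
  rewrite extend_last leq_eqVlt => /predU1P[->|jk]; first by rewrite extend_last eqxx dotxx x1.
  by rewrite extend_lt// xu// gtn_eqF.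
rewrite leq_eqVlt (extend_lt _ _ ik) => /predU1P[->|jk].
  by rewrite extend_last dotC xu// conjc0 ltn_eqF.
by rewrite extend_lt// ou.
Qed.
Lemma oproj_extend k u x y : oproj k.+1 (extend k u x) y = oproj k u y + dot y x *: x.
Proof.
rewrite /oproj big_ord_recr /= extend_last; congr (_ + _).
by apply: eq_bigr => i _; rewrite extend_lt.
Qed.

Lemma normalize x : x != 0 -> exists a : R, 0 < a /\ sqnorm (a%:C *: x) = 1.
Proof.
move=> x0; have nx : 0 < sqnorm x by rewrite lt_neqAle sqnorm_ge0 eq_sym sqnorm_eq0 x0.
exists (Num.sqrt (sqnorm x))^-1; rewrite invr_gt0 sqrtr_gt0 nx; split=> //.
by rewrite sqnormZ sqn_real exprVn sqr_sqrtr ?sqnorm_ge0// mulVf ?gt_eqF.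
Qed.

Lemma normalizeE x : exists a y,
  x = a%:C *: y /\ 0 <= a /\ a ^+ 2 = sqnorm x /\ (x != 0 -> sqnorm y = 1).
Proof.
have [->|x0] := eqVneq x 0.
  by exists 0, 0; rewrite scaler0 sqnorm0 expr0n.
have [a [a0 na]] := normalize x0.
exists a^-1, (a%:C *: x); rewrite scalerA -RCM mulVf ?gt_eqF// scale1r invr_ge0 ltW//.
do 3!split=> //.
move: na; rewrite sqnormZ sqn_real => na; apply: (mulfI (lt0r_neq0 (exprn_gt0 2 a0))).
by rewrite na -exprMn divff ?expr1n// gt_eqF.
Qed.

Lemma gram_schmidt_step D w x : orthofam D w -> x - oproj D w x != 0 ->
  exists a : R, let y := a%:C *: (x - oproj D w x) in
  [/\ orthofam D.+1 (extend D w y), x = oproj D.+1 (extend D w y) x &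
    forall z, z = oproj D w z -> z = oproj D.+1 (extend D w y) z].
Proof.
set r := x - _ => ow r0; have [a [a0 na]] := normalize r0; exists a => /=.
have rw i : (i < D)%N -> dot r (w i) = 0 by move=> iD; rewrite oproj_res.
have rw' i : (i < D)%N -> dot (a%:C *: r) (w i) = 0 by move=> iD; rewrite dotZl rw// mulr0.
split=> [||z zE]; [exact: orthofam_extend| |]; rewrite oproj_extend.
  have -> : dot x (a%:C *: r) *: (a%:C *: r) = r.
    rewrite dotZr conjc_real scalerA (_ : dot x r = dot r r).
      by move: na; rewrite sqnormZ sqn_real => na; rewrite dotxx -!RCM mulrAC -expr2 na scale1r.
    by rewrite [in RHS]/r dotBl [dot (oproj D w x) r]dotC oproj_perp// conjc0 subr0.
  by rewrite addrC /r subrK.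
by rewrite -zE [dot z _]dotC zE oproj_perp// conjc0 scale0r addr0.
Qed.

(** Vectors already in the span are skipped, so l may be dependent. This is how finitely many
    vectors are gathered in one finite-dimensional space. *)
Lemma gram_schmidt (l : seq H) : exists D w, orthofam D w /\ forall x, x \in l -> x = oproj D w x.
Proof.
elim: l => [|x l [D [w [ow wl]]]]; first by exists 0%N, (fun=> 0).
have [r0|r0] := eqVneq (x - oproj D w x) 0.
  exists D, w; split=> // y; rewrite inE => /predU1P[->|]; last exact: wl.
  by apply/eqP; rewrite -subr_eq0 r0.
have [a /= [oa xE zE]] := gram_schmidt_step ow r0.
exists D.+1, (extend D w (a%:C *: (x - oproj D w x))); split=> // y.
by rewrite inE => /predU1P[->//|yl]; apply/zE/wl.
Qed.

(** Independence keeps every residual nonzero, so the length k is preserved. Both inclusions of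
    spans are recorded, since the range of a projection has to be recovered exactly. *)
Lemma gram_schmidt_indep k v :
  (forall a : nat -> R[i], \sum_(i < k) a i *: v i = 0 -> forall i, (i < k)%N -> a i = 0) ->
  exists u, [/\ orthofam k u, forall i, (i < k)%N -> v i = oproj k u (v i) &
    forall i, (i < k)%N -> exists a : nat -> R[i], u i = \sum_(j < k) a j *: v j].
Proof.
elim: k => [|k IH] vi; first by exists (fun=> 0); split.
have [a a0 i ik|u [ou uv vu]] := IH.
  have := vi (fun i => if (i < k)%N then a i else 0).
  rewrite big_ord_recr /= ltnn scale0r addr0 => /(_ _ i)/=; rewrite ik; apply; last exact: ltnW.
  by rewrite -[RHS]a0; apply: eq_bigr => j _; rewrite ltn_ord.
pose r := v k - oproj k u (v k).
(* Writing the residual in terms of [v] serves twice: independence shows that it is nonzero, and it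
   yields the coefficients of the new vector. *)
have rspan : exists b : nat -> R[i], r = v k - \sum_(j < k) b j *: v j.
  have /choice [c cP] : forall i, exists a : nat -> R[i], (i < k)%N -> u i = \sum_(j < k) a j *: v j.
    by move=> i; case: (ltnP i k) => [/vu[a aE]|]; [exists a|exists (fun=> 0)].
  exists (fun j => \sum_(i < k) dot (v k) (u i) * c i j); rewrite /r /oproj; congr (_ - _).
  under eq_bigr => i _ do rewrite {2}cP// scaler_sumr.
  rewrite exchange_big; apply: eq_bigr => j _; rewrite scaler_suml.
  by apply: eq_bigr => i _; rewrite scalerA.
have [b rE] := rspan.
have r0 : r != 0.
  apply/eqP => r0; have := vi (fun i => if (i < k)%N then - b i else 1).
  rewrite big_ord_recr /= ltnn scale1r => /(_ _ k); rewrite ltnn ltnSn => h.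
  have : (1 : R[i]) = 0; last by move/eqP; rewrite oner_eq0.
  apply: h => //; rewrite -[RHS]r0 rE addrC; congr (_ + _).
  by rewrite -sumrN; apply: eq_bigr => j _; rewrite ltn_ord scaleNr.
have [a /= [oa xE zE]] := gram_schmidt_step ou r0.
exists (extend k u (a%:C *: r)); split=> //.
  by move=> i; rewrite ltnS leq_eqVlt => /predU1P[->//|ik]; apply/zE/uv.
move=> i; rewrite ltnS leq_eqVlt => /predU1P[->|ik].
  exists (fun j => a%:C * (if (j < k)%N then - b j else 1)); rewrite extend_last rE.
  rewrite big_ord_recr /= ltnn mulr1 scalerBr addrC; congr (_ + _).
  rewrite scaler_sumr -sumrN; apply: eq_bigr => j _.
  by rewrite ltn_ord mulrN scaleNr scalerA.
have [c cE] := vu i ik; exists (fun j => if (j < k)%N then c j else 0).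
rewrite extend_lt// big_ord_recr /= ltnn scale0r addr0 cE.
by apply: eq_bigr => j _; rewrite ltn_ord.
Qed.

End InnerProduct.

(** * Parseval identity and traces against projections *)

Section ProjectionTraces.
Context {R : realType} {H : completeNormedModType R[i]}.
Variable dot : {dot H for Num.conj}.
Implicit Types (x y z : H) (u v w e : nat -> H) (k D : nat).
Local Notation sqnorm := (sqnorm dot).
Local Notation orthofam := (orthofam dot).
Local Notation oproj := (oproj dot).

Lemma oproj_is_linear k u : linear (oproj k u).
Proof. by move=> a x y; rewrite oprojD oprojZ. Qed.
HB.instance Definition _ k u :=
  GRing.isLinear.Build R[i] H H _ (oproj k u) (@oproj_is_linear k u).

Definition qform (S : H -> H) x : R := Re (dot (S x) x).

Lemma complex_gt0 (r : R[i]) : 0 < r -> exists a : R, 0 < a /\ r = a%:C.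
Proof. by case: r => a b; rewrite ltcE /= => /andP[/eqP -> a0]; exists a. Qed.

Lemma selfadj_real (S : H -> H) x : selfadjoint dot S -> dot (S x) x = (qform S x)%:C.
Proof.
move=> sS; have := sS x x; rewrite [RHS]dotC /qform; case: (dot (S x) x) => a b [] h.
by congr (_ +i* _); move: h; lra.
Qed.

Hypothesis dot_norm : hilbert_norm dot.

Lemma normE x : `|x| = (Num.sqrt (sqnorm x))%:C.
Proof.
apply/eqP; rewrite -(@eqrXn2 _ 2) ?ler0c ?sqrtr_ge0//.
by rewrite dot_norm dotxx -rmorphXn /= sqr_sqrtr// sqnorm_ge0.
Qed.

Lemma norm_lt x (a : R) : 0 < a -> (`|x| < a%:C) = (sqnorm x < a ^+ 2).
Proof.
move=> a0; rewrite normE ltcR -{2}(sqr_sqrtr (sqnorm_ge0 dot x)).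
by rewrite ltr_pXn2r// nnegrE ?sqrtr_ge0// ltW.
Qed.
Lemma norm_le x (a : R) : 0 <= a -> (`|x| <= a%:C) = (sqnorm x <= a ^+ 2).
Proof.
move=> a0; rewrite normE lecR -{2}(sqr_sqrtr (sqnorm_ge0 dot x)).
by rewrite ler_pXn2r// nnegrE ?sqrtr_ge0.
Qed.

Lemma bounded_opP (S : H -> H) :
  bounded_op S <-> exists s : R, 0 <= s /\ forall x, sqnorm (S x) <= s ^+ 2 * sqnorm x.
Proof.
split=> [[M hM]|[s [s0 hs]]].
  exists `|M|; split=> // x.
  have : `|S x| <= (`|M| * Num.sqrt (sqnorm x))%:C.
    apply: le_trans (hM x) _; rewrite normE -RCM lecR ler_wpM2r ?sqrtr_ge0//.
    exact: ler_norm.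
  by rewrite norm_le ?mulr_ge0 ?sqrtr_ge0// exprMn sqr_sqrtr ?sqnorm_ge0.
exists s => x; rewrite (normE x) -RCM norm_le ?mulr_ge0 ?sqrtr_ge0//.
by rewrite exprMn sqr_sqrtr ?sqnorm_ge0.
Qed.

Definition expands e := forall x (eps : R), 0 < eps ->
  exists N, forall n, (N <= n)%N -> sqnorm (x - oproj n e x) <= eps.

Lemma dense_sqnorm (A : set H) x (eps : R) : dense A -> 0 < eps ->
  exists y, A y /\ sqnorm (x - y) < eps.
Proof.
move=> dA e0; have [||y [yB Ay]] := dA (ball x (Num.sqrt eps)%:C).
- by exists x; apply: ballxx; rewrite ltcR sqrtr_gt0.
- exact: ball_open.
exists y; split=> //; move: yB; rewrite -ball_normE /= norm_lt ?sqrtr_gt0//.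
by rewrite sqr_sqrtr// ltW.
Qed.

Lemma onb_orthofam e k : orthonormal_basis dot e -> orthofam k e.
Proof. by case=> he _ i j _ _; rewrite he. Qed.

(** Density gives a vector near x in the span of the first k terms; projections on longer initial
    segments do at least as well by [res_le]. *)
Lemma onb_expands e : orthonormal_basis dot e -> expands e.
Proof.
move=> be; have [_ de] := be; move=> x eps e0.
have [y [[k _ [a _ yE]] xy]] := dense_sqnorm x de e0.
exists k => n kn; apply: le_trans _ (ltW xy); apply: res_le (onb_orthofam be) _.
rewrite -yE raddf_sum; apply: eq_bigr => i _.
by rewrite /= oprojZ oproj_id//; [exact: onb_orthofam|exact: leq_trans (ltn_ord i) kn].
Qed.

Lemma expands_eq0 e x : expands e -> (forall i, dot x (e i) = 0) -> x = 0.
Proof.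
move=> ce h; apply/eqP; rewrite -(sqnorm_eq0 dot) eq_le sqnorm_ge0 andbT.
apply/ler_addgt0Pr => eps e0; rewrite add0r.
have [N /(_ N (leqnn N))] := ce x eps e0; rewrite [oproj _ _ _](_ : _ = 0) ?subr0//.
by rewrite /oproj big1// => i _; rewrite h scale0r.
Qed.

Lemma cvgC_sqnorm (f : nat -> R[i]) (l : R[i]) :
  (forall eps : R, 0 < eps -> exists N, forall n, (N <= n)%N -> sqn (l - f n) <= eps) ->
  (f : nat -> R[i]^o) @ \oo --> (l : R[i]^o).
Proof.
move=> h; apply/cvgrPdist_le => eps /complex_gt0 [a [a0 ->]].
have [N hN] := h (a ^+ 2) (exprn_gt0 2 a0).
exists N => // n /= Nn; rewrite normc_def lecR -/(sqn _) -(ger0_norm (ltW a0)) -sqrtr_sqr.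
by rewrite ler_sqrt; [exact: hN|rewrite exprn_ge0// ltW].
Qed.

Lemma parseval e x y : orthonormal_basis dot e ->
  (fun n => \sum_(i < n) dot x (e i) * dot (e i) y : R[i]^o) @ \oo --> (dot x y : R[i]^o).
Proof.
move=> be; apply: cvgC_sqnorm => eps e0.
(* The summand 1 keeps the divisor positive when y = 0. *)
have y1 : 0 < sqnorm y + 1 by rewrite ltr_wpDl ?sqnorm_ge0.
have [N hN] := onb_expands be x (divr_gt0 e0 y1).
exists N => n Nn; rewrite -dot_oproj -dotBl.
apply: le_trans (CauchySchwarz_sqn _ _ _) _.
have := hN n Nn; rewrite ler_pdivlMr// => h; apply: le_trans h.
by rewrite ler_wpM2l ?sqnorm_ge0// lerDl.
Qed.

(** Once the projection is expanded and the sums are exchanged, each u_i contributes the Parseval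
    series of <S u_i, u_i>; hence the value does not depend on e. *)
Lemma trace_proj e k u (S : {linear H -> H}) : orthonormal_basis dot e ->
  series (fun n => dot ((S \o oproj k u) (e n)) (e n) : R[i]^o) @ \oo -->
  (\sum_(i < k) dot (S (u i)) (u i) : R[i]^o).
Proof.
move=> be; rewrite [X in X @ _ --> _](_ : _ =
    fun n => \sum_(i < k) \sum_(j < n) (dot (S (u i)) (e j) * dot (e j) (u i) : R[i]^o)).
  by apply: cvg_big => [|i _]; [exact: add_continuous|exact: parseval].
apply/funext => n; rewrite /series /= big_mkord exchange_big; apply: eq_bigr => j _.
rewrite /oproj raddf_sum dot_suml; apply: eq_bigr => i _.
by rewrite /= linearZ_LR dotZl mulrC.
Qed.

Lemma has_dim_orthofam (V : set H) k : has_dim V k ->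
  exists u, [/\ orthofam k u, forall x, V x -> x = oproj k u x & forall i, (i < k)%N -> V (u i)].
Proof.
move=> [v [vi ->]]; pose v' i := oapp v 0 (insub i).
have v'E (i : 'I_k) : v' i = v i by rewrite /v' valK.
have [a a0 i ik|u [ou uv vu]] := @gram_schmidt_indep _ _ dot k v'.
  apply: (vi (a \o val) _ (Ordinal ik)); rewrite -[RHS]a0.
  by apply: eq_bigr => j _; rewrite v'E.
exists u; split=> //.
  move=> x [a _ <-]; rewrite raddf_sum; apply: eq_bigr => i _.
  by rewrite /= oprojZ -v'E -uv.
move=> i /vu [a ->]; exists (a \o val) => //.
by apply: eq_bigr => j _; rewrite v'E.
Qed.

(** A selfadjoint idempotent fixes its range, so <P x, u_i> = <x, u_i> for an orthonormal basis u of
    the range. *)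
Lemma orth_proj_projE k (P : {linear H -> H}) : orth_proj dot k P ->
  exists u, orthofam k u /\ P =1 oproj k u.
Proof.
move=> [_ PP sP /has_dim_orthofam [u [ou Pu uP]]]; exists u; split=> // x.
have Puid i : (i < k)%N -> P (u i) = u i.
  by move=> /uP [y _ <-]; rewrite -[in LHS]/((P \o P) y) PP.
rewrite (Pu (P x)); last by exists x.
by apply: eq_bigr => i _; rewrite sP Puid.
Qed.

Lemma proj_orth_proj k u : orthofam k u -> orth_proj dot k (oproj k u).
Proof.
move=> ou; split.
- apply/bounded_opP; exists 1; split=> // x.
  by rewrite expr1n mul1r sqnorm_oproj// bessel.
- by apply/funext => x /=; rewrite oproj_idem.
- by move=> x y; rewrite oproj_selfadj.
exists (u \o val); split.
  move=> a a0 i; have := congr1 (fun x => dot x (u i)) a0.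
  rewrite dot0l dot_suml (bigD1 i) //= dotZl ou// eqxx mulr1.
  rewrite big1 ?addr0// => j ji; rewrite dotZl ou//.
  by rewrite (inj_eq val_inj) (negbTE ji) mulr0.
apply/seteqP; split=> [_ [x _ <-]|_ [a _ <-]] /=.
  by exists (fun i : 'I_k => dot x (u i)).
exists (\sum_(i < k) a i *: u i) => //.
rewrite raddf_sum; apply: eq_bigr => i _.
by rewrite /= oprojZ oproj_id.
Qed.

(** Reduces U_k(S) and L_k(S) to extrema over orthonormal families, the form in which all later
    estimates are made. *)
Lemma proj_tracesE e (S : {linear H -> H}) k : orthonormal_basis dot e -> selfadjoint dot S ->
  proj_traces dot S k = [set t | exists u, orthofam k u /\ t = \sum_(i < k) qform S (u i)].
Proof.
move=> be sS; have trE u : (\sum_(i < k) qform S (u i))%:C = \sum_(i < k) dot (S (u i)) (u i).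
  by rewrite RC_sum; apply: eq_bigr => i _; rewrite selfadj_real.
apply/seteqP; split=> t /=.
  move=> [P [/orth_proj_projE [u [ou Pu]] trP]]; exists u; split=> //.
  apply: complexI; rewrite trE.
  apply: cvg_unique (trP e be) _; first exact: norm_hausdorff.
  rewrite (_ : S \o P = S \o oproj k u); last by apply/funext => x /=; rewrite Pu.
  exact: trace_proj.
move=> [u [ou ->]]; exists (oproj k u); split; first exact: proj_orth_proj.
by move=> e' be'; rewrite trE; exact: trace_proj.
Qed.
End ProjectionTraces.

(** * Coercive operators and compact operators *)

Section Completeness.
Context {R : realType} {H : completeNormedModType R[i]}.
Variable dot : {dot H for Num.conj}.
Implicit Types (x y z : H) (u v w e : nat -> H) (k D : nat).
Local Notation sqnorm := (sqnorm dot).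
Local Notation orthofam := (orthofam dot).
Local Notation oproj := (oproj dot).
Local Notation qform := (qform dot).
Hypothesis dot_norm : hilbert_norm dot.

Lemma geometric_le (q C : R) (eps : R) : 0 <= q < 1 -> 0 < eps ->
  exists N, forall n, (N <= n)%N -> C * q ^+ n <= eps.
Proof.
move=> /andP[q0 q1] e0.
have : (fun n => C * q ^+ n) @ \oo --> C * 0.
  by apply: cvgMl_tmp; apply: cvg_expr; rewrite ger0_norm.
rewrite mulr0 => /cvgrPdist_le /(_ _ e0) [N _ hN].
exists N => n /hN /=; rewrite sub0r normrN; exact: le_trans (ler_norm _).
Qed.

Lemma cauchy_sqnorm (x : nat -> H) :
  (forall eps : R, 0 < eps -> exists N, forall m n, (N <= m)%N -> (N <= n)%N ->
    sqnorm (x m - x n) <= eps) ->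
  exists l, forall eps : R, 0 < eps -> exists N, forall n, (N <= n)%N -> sqnorm (l - x n) <= eps.
Proof.
move=> h; have : cvg (x @ \oo).
  apply/cauchy_cvgP/cauchy_ballP => eps /complex_gt0 [a [a0 ->]].
  have a2 : 0 < a ^+ 2 / 2 by rewrite divr_gt0 ?exprn_gt0.
  have [N hN] := h _ a2.
  exists (x @` [set n | (N <= n)%N], x @` [set n | (N <= n)%N]) => /=.
    by split; exists N => // n /= Nn; exists n.
  move=> [_ _] [/= [m Nm <-] [n Nn <-]]; rewrite -ball_normE /= (norm_lt dot_norm)//.
  apply: le_lt_trans (hN m n Nm Nn) _; rewrite ltr_pdivrMr// ltr_pMr ?exprn_gt0//; lra.
move=> /cvgrPdist_le hl; exists (lim (x @ \oo)) => eps e0.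
have s0 : 0 < Num.sqrt eps by rewrite sqrtr_gt0.
have : 0 < (Num.sqrt eps)%:C by rewrite ltcR.
move=> /hl [N _ hN]; exists N => n /hN /=.
by rewrite (norm_le dot_norm _ (ltW s0)) (sqr_sqrtr (ltW e0)).
Qed.

Lemma sqnorm_lim_eq x y : (forall eps : R, 0 < eps -> sqnorm (x - y) <= eps) -> x = y.
Proof.
move=> h; apply/eqP; rewrite -subr_eq0 -(sqnorm_eq0 dot) eq_le sqnorm_ge0 andbT.
by apply/ler_addgt0Pr => eps e0; rewrite add0r h.
Qed.

(* The solution of A x = y is the limit of x + t (y - A x), a contraction for t = d / b. *)
Lemma coercive_inv (A : {linear H -> H}) (b d : R) : 0 < d ->
  (forall x, sqnorm (A x) <= b * sqnorm x) -> (forall x, d * sqnorm x <= Re (dot (A x) x)) ->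
  exists B : {linear H -> H}, [/\ bounded_op B, forall x, B (A x) = x & forall x, A (B x) = x].
Proof.
(* Enlarging b until d^2 <= b puts the contraction factor 1 - d^2 / b into [0, 1). *)
move=> d0; wlog [b0 db] : b / 0 < b /\ d ^+ 2 <= b => [hw hb hd|hb hd].
  have bd : 0 <= d ^+ 2 by rewrite sqr_ge0.
  have bp : 0 < `|b| + d ^+ 2 + 1 by have := normr_ge0 b; lra.
  apply: (hw (`|b| + d ^+ 2 + 1)) => // [|x].
    by split=> //; have := normr_ge0 b; lra.
  by apply: le_trans (hb x) _; rewrite ler_wpM2r ?sqnorm_ge0//; have := ler_norm b; lra.
have low x : d ^+ 2 * sqnorm x <= sqnorm (A x).
  have di : 0 < d^-1 by rewrite invr_gt0.
  have := young dot (A x) x di.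
  have := hd x; rewrite invrK => h1 h2.
  have : d * sqnorm x <= d^-1 * sqnorm (A x) by lra.
  by rewrite -(ler_pM2l d0) !mulrA -expr2 divff ?gt_eqF// mul1r.
have inj x y : A x = A y -> x = y.
  move=> h; apply/eqP; rewrite -subr_eq0 -(sqnorm_eq0 dot) eq_le sqnorm_ge0 andbT.
  have := low (x - y); rewrite raddfB /= h subrr sqnorm0 => {}h.
  by rewrite -(ler_pM2l (exprn_gt0 2 d0)) mulr0.
have surj y : exists x, A x = y.
  (* This t minimizes the factor 1 - 2 t d + t^2 b in the bound for |r - t A r|^2; the minimum is
     [q]. *)
  pose t := d / b; have t0 : 0 < t by rewrite divr_gt0.
  pose step x := x + t%:C *: (y - A x).
  pose x n := iter n step 0.
  pose q := 1 - d ^+ 2 / b.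
  have contr r : sqnorm (r - t%:C *: A r) <= q * sqnorm r.
    rewrite sqnormB sqnormZ sqn_real dotZr conjc_real ReZ Re_dotC.
    have h1 := hd r; have h2 := hb r.
    have : t ^+ 2 * sqnorm (A r) <= t ^+ 2 * (b * sqnorm r) by rewrite ler_wpM2l ?sqr_ge0.
    have -> : t ^+ 2 * (b * sqnorm r) = t * d * sqnorm r by rewrite /t; field; rewrite gt_eqF.
    have : t * (d * sqnorm r) <= t * Re (dot (A r) r) by rewrite ler_wpM2l// ltW.
    have -> : q = 1 - t * d by rewrite /q /t; field; rewrite gt_eqF.
    lra.
  have q01 : 0 <= q < 1.
    by rewrite /q ltrBlDr ltrDl divr_gt0 ?exprn_gt0// andbT subr_ge0 ler_pdivrMr// mul1r.
  have q0 : 0 <= q by case/andP: q01.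
  have res n : sqnorm (y - A (x n)) <= sqnorm y * q ^+ n.
    elim: n => [|n IH]; first by rewrite /x /= raddf0 subr0 expr0 mulr1.
    rewrite /x /= -/(x n) /step raddfD /= linearZ_LR opprD addrA.
    apply: le_trans (contr _) _; rewrite exprS mulrCA; exact: ler_wpM2l.
  (* The residuals y - A x_n decay geometrically, and [low] carries this over to the x_n. *)
  have [eps e0|l hl] := @cauchy_sqnorm x.
    have de : 0 < d ^+ 2 * eps / 4 by rewrite divr_gt0// mulr_gt0// exprn_gt0.
    have [N hN] := geometric_le (sqnorm y) q01 de.
    exists N => m n Nm Nn; rewrite -(ler_pM2l (exprn_gt0 2 d0)).
    apply: le_trans (low _) _; rewrite raddfB /=.
    have -> : A (x m) - A (x n) = (y - A (x n)) + - (y - A (x m)).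
      by rewrite opprB [RHS]addrC addrA subrK.
    apply: le_trans (sqnormD_le _ _ _) _; rewrite sqnormN.
    have := hN m Nm; have := hN n Nn; have := res m; have := res n; lra.
  exists l; apply: sqnorm_lim_eq => eps e0.
  have e4 : 0 < eps / 4 by rewrite divr_gt0.
  have [N1 h1] := hl _ (divr_gt0 e4 b0); have [N2 h2] := geometric_le (sqnorm y) q01 e4.
  pose N := maxn N1 N2; have := h1 N (leq_maxl _ _); have := h2 N (leq_maxr _ _).
  have := res N; have := hb (l - x N); rewrite raddfB /= => h3 h4 h5.
  rewrite ler_pdivlMr// => h6.
  have -> : A l - y = (A l - A (x N)) + - (y - A (x N)).
    by rewrite opprB addrA subrK.
  apply: le_trans (sqnormD_le _ _ _) _; rewrite sqnormN; lra.
have [B BE] := choice surj.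
have Blin : linear B.
  by move=> a x y; apply: inj; rewrite linearP !BE.
pose B' : {linear H -> H} := HB.pack B (GRing.isLinear.Build R[i] H H _ B Blin).
exists B'; split=> [|x|x]; last exact: BE; last by apply: inj; rewrite BE.
apply/(bounded_opP dot_norm); exists d^-1; split=> [|x]; first by rewrite invr_ge0 ltW.
rewrite -(ler_pM2l (exprn_gt0 2 d0)) mulrA -exprMn divff ?gt_eqF// expr1n mul1r.
by rewrite -{2}(BE x); exact: low.
Qed.

(** Dependent choice along finite families. Q may inspect only the first k terms, so what is secured
    at stage k survives in the final sequence, which agrees with that stage below k. *)
Lemma orthofam_build (Q : nat -> (nat -> H) -> H -> Prop) N (f0 : nat -> H) : orthofam N f0 ->
  (forall k u u' x, (forall i, (i < k)%N -> u i = u' i) -> Q k u x -> Q k u' x) ->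
  (forall k u, (N <= k)%N -> orthofam k u ->
    exists x, [/\ sqnorm x = 1, forall i, (i < k)%N -> dot x (u i) = 0 & Q k u x]) ->
  exists f, [/\ forall k, orthofam k f, forall i, (i < N)%N -> f i = f0 i &
    forall k, (N <= k)%N -> Q k f (f k)].
Proof.
move=> o0 Qext hQ.
have /choice [step stepP] : forall p : nat * (nat -> H), exists x, (N <= p.1)%N -> orthofam p.1 p.2 ->
    [/\ sqnorm x = 1, forall i, (i < p.1)%N -> dot x (p.2 i) = 0 & Q p.1 p.2 x].
  move=> [k u] /=; have [[Nk ou]|no] := pselect ((N <= k)%N /\ orthofam k u).
    by have [x hx] := hQ k u Nk ou; exists x.
  by exists 0 => Nk ou; case: no.
pose F := fix F n := if n is m.+1 then extend (N + m) (F m) (step ((N + m)%N, F m)) else f0.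
have oF n : orthofam (N + n) (F n).
  elim: n => [|n IH]; first by rewrite addn0.
  rewrite addnS; have [? ? _] := stepP (_, F n) (leq_addr n N) IH.
  exact: orthofam_extend.
have Fst n m i : (i < N + n)%N -> (n <= m)%N -> F m i = F n i.
  move=> iN; elim: m => [|m IH]; first by rewrite leqn0 => /eqP ->.
  rewrite leq_eqVlt => /predU1P[->//|nm]; rewrite /= extend_lt ?IH//.
  by apply: leq_trans iN _; rewrite leq_add2l.
(* Term i is settled at stage i.+1, because i < N + i.+1. *)
pose f i := F i.+1 i.
have fE n i : (i < N + n)%N -> f i = F n i.
  move=> iN; rewrite /f; have [h|h] := leqP n i.+1; first by rewrite (Fst n).
  by rewrite (Fst i.+1 n)// ?addnS ?ltnS ?leq_addl// ltnW.
exists f; split=> [k i j ik jk|i iN|k Nk].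
- rewrite (fE k) ?(leq_trans ik (leq_addl _ _))// (fE k) ?(leq_trans jk (leq_addl _ _))//.
  by rewrite oF// ?(leq_trans ik (leq_addl _ _))// ?(leq_trans jk (leq_addl _ _)).
- by rewrite (fE 0%N) ?addn0.
- have [n kE] : exists n, k = (N + n)%N by exists (k - N)%N; rewrite subnKC.
  have [_ _ h] := stepP (_, F n) (leq_addr n N) (oF n).
  have -> : f k = step ((N + n)%N, F n).
    by rewrite (fE n.+1) kE ?addnS// /= extend_last.
  rewrite kE; apply: Qext h => i iN /=; by rewrite (fE n).
Qed.

(** A cluster point of the values is approached at arbitrarily late indices, so two such indices can
    be taken in order. *)
Lemma compact_op_close_values (K : H -> H) (x : nat -> H) (d : R) :
  compact_op K -> (forall n, sqnorm (x n) <= 1) -> 0 < d ->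
  exists i j, (i < j)%N /\ sqnorm (K (x i) - K (x j)) <= d.
Proof.
move=> cK x1 d0.
have xK n : (K @` [set x | `|x| <= 1]) (K (x n)).
  by exists (x n) => //=; rewrite -[1]/((1:R)%:C) (norm_le dot_norm)// expr1n.
move: cK; rewrite /compact_op precompactE => /(_ ((K \o x) @ \oo)).
case=> [|l [_ cl]].
  by exists 0%N => // n _; apply: subset_closure; exact: xK.
have d4 : 0 < d / 4 by rewrite divr_gt0.
pose B := ball l (Num.sqrt (d / 4))%:C.
have nB : nbhs l B by apply: nbhsx_ballx; rewrite ltcR sqrtr_gt0.
have Bn z : B z -> sqnorm (l - z) <= d / 4.
  by rewrite /B -ball_normE /= (norm_lt dot_norm) ?sqrtr_gt0// (sqr_sqrtr (ltW d4)) => /ltW.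
have get m : exists n, (m <= n)%N /\ sqnorm (l - K (x n)) <= d / 4.
  have [|_ [[n /= mn <-] /Bn h]] := cl ((K \o x) @` [set n | (m <= n)%N]) B _ nB.
    by exists m => // n /= mn; exists n.
  by exists n.
have [i [_ hi]] := get 0%N; have [j [ij hj]] := get i.+1.
exists i, j; split=> //.
have -> : K (x i) - K (x j) = (l - K (x j)) + - (l - K (x i)).
  by rewrite opprB [RHS]addrC addrA subrK.
apply: le_trans (sqnormD_le _ _ _) _; rewrite sqnormN; lra.
Qed.

Lemma compact_square (C : R) : compact [set z : R[i]^o | `|Re z| <= C /\ `|Im z| <= C].
Proof.
have -> : [set z : R[i]^o | `|Re z| <= C /\ `|Im z| <= C] =
    (fun p : R * R => (p.1%:C + 'i%C * p.2%:C : R[i]^o)) @` (`[- C, C] `*` `[- C, C]).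
  apply/seteqP; split=> [z /= [hr hi]|_ [[a b] [/= ha hb] <-]] /=.
    exists (Re z, Im z); last by rewrite [RHS]complexE.
    by split; rewrite /= in_itv /= -ler_norml.
  move: ha hb; rewrite !in_itv /= -!ler_norml.
  by rewrite /= !(mul0r, mul1r, mulr0, addr0, subr0, add0r, subrr).
apply: continuous_compact; last by apply: compact_setX; exact: segment_compact.
have crc : continuous (fun a : R => (a%:C : R[i]^o)).
  move=> a; apply/cvgrPdist_le => eps /complex_gt0 [d [d0 ->]].
  have /cvgrPdist_le /(_ d d0) : (id : R -> R) @ a --> a by exact: cvg_id.
  apply: filterS => t; rewrite /= -RCB normc_def /= expr0n addr0 sqrtr_sqr lecR; exact.
apply: continuous_subspaceT => p.
apply: cvgD; first by apply: continuous_comp; [exact: cvg_fst|exact: crc].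
apply: (@cvgM R[i] _ _ _ (fun=> 'i%C) _ 'i%C); first exact: cvg_cst.
by apply: continuous_comp; [exact: cvg_snd|exact: crc].
Qed.

(** The coefficients stay in a compact square, so the values lie in a continuous image of a product
    of D squares, built by induction on D. *)
Lemma finite_rank_compact (K : H -> H) D (g : nat -> H) (C : R) :
  (forall x, sqnorm x <= 1 -> exists a : nat -> R[i],
     (forall i, (i < D)%N -> sqn (a i) <= C) /\ K x = \sum_(i < D) a i *: g i) ->
  compact_op K.
Proof.
(* The bound C + 1 avoids a square root: a^2 <= C implies |a| <= C + 1. *)
move=> hK; pose Q := [set z : R[i] | `|Re z| <= C + 1 /\ `|Im z| <= C + 1].
have CQ (z : R[i]) : sqn z <= C -> Q z.
  rewrite /sqn /Q /= !ler_norml => h; have := sqr_ge0 (Re z); have := sqr_ge0 (Im z) => h1 h2.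
  by split; apply/andP; split; nra.
pose A D := [set y | exists a : nat -> R[i],
     (forall i, (i < D)%N -> Q (a i)) /\ y = \sum_(i < D) a i *: g i].
have cA : compact (A D).
  elim: (D) => [|n IH].
    rewrite (_ : A 0%N = [set 0]); first exact: compact_set1.
    apply/seteqP; split=> [y [a [_ ->]]|_ ->] /=; first by rewrite big_ord0.
    by exists (fun=> 0); split=> //; rewrite big_ord0.
  rewrite (_ : A n.+1 = (fun p : R[i]^o * H => p.1 *: g n + p.2) @` ((Q : set R[i]^o) `*` A n)).
    apply: continuous_compact; last by apply: compact_setX => //; exact: compact_square.
    apply: continuous_subspaceT => p.
    apply: cvgD; last exact: cvg_snd.
    by apply: cvgZr_tmp; exact: cvg_fst.
  apply/seteqP; split=> [y [a [ha ->]]|_ [[z y] [/= hz [a [ha ->]]] <-]] /=.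
    exists (a n, \sum_(i < n) a i *: g i) => /=; last by rewrite big_ord_recr addrC.
    split; first exact: ha.
    by exists a; split=> // i iN; apply: ha; exact: ltnW.
  exists (fun i => if (i < n)%N then a i else z); split.
    by move=> i _; case: ifP => // ii; exact: ha.
  rewrite big_ord_recr /= ltnn addrC; congr (_ + _).
  by apply: eq_bigr => j _; rewrite ltn_ord.
apply: (@precompact_subset _ _ (A D)) => [_ [x /= x1 <-]|].
  move: x1; rewrite -[1]/((1:R)%:C) (norm_le dot_norm)// expr1n => /hK [a [ha ->]].
  by exists a; split=> // i iD; exact/CQ/ha.
by apply: compact_precompact => //; exact: norm_hausdorff.
Qed.
End Completeness.

(** * The upper essential bound of a selfadjoint operator *)

Section EssentialBound.
Context {R : realType} {H : completeNormedModType R[i]}.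
Variable dot : {dot H for Num.conj}.
Implicit Types (x y z : H) (u v w : nat -> H) (k D : nat).
Local Notation sqnorm := (sqnorm dot).
Local Notation orthofam := (orthofam dot).
Local Notation oproj := (oproj dot).
Local Notation qform := (qform dot).

(** The double sum of |<u_i, w_j>|^2 equals k when summed over j first, and is at most D, by Bessel,
    when summed over i first. *)
Lemma orthofam_dim_le k u D w : orthofam k u -> orthofam D w ->
  (forall i, (i < k)%N -> u i = oproj D w (u i)) -> (k <= D)%N.
Proof.
move=> ou ow uw; rewrite -(ler_nat R).
have -> : (k%:R : R) = \sum_(i < k) \sum_(j < D) sqn (dot (u i) (w j)).
  rewrite -[LHS]mulr_natl mulr1 -[k in LHS]card_ord -sumr_const; apply: eq_bigr => i _.
  by rewrite -sqnorm_oproj// -uw// (orthofam_sqnorm ou).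
rewrite exchange_big -[leRHS]mulr_natl mulr1 -[D in leRHS]card_ord -sumr_const; apply: ler_sum => j _.
rewrite -[leRHS](orthofam_sqnorm ow (ltn_ord j)); apply: le_trans (bessel _ ou).
by apply: ler_sum => i _; rewrite sqn_dotC.
Qed.

Variable e : nat -> H.
Hypothesis oe : forall k, orthofam k e.

(** If every e_i had zero residual, D + 1 orthonormal vectors would lie in a space of dimension
    D. *)
Lemma perp_unit D w : orthofam D w ->
  exists y, sqnorm y = 1 /\ forall i, (i < D)%N -> dot y (w i) = 0.
Proof.
move=> ow; have [|no] := pselect (exists i, e i - oproj D w (e i) != 0).
  move=> [i r0]; have [a [_ na]] := normalize dot r0; exists (a%:C *: (e i - oproj D w (e i))).
  by split=> // j jD; rewrite dotZl oproj_res// mulr0.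
suff: (D.+1 <= D)%N by rewrite ltnn.
apply: (orthofam_dim_le (@oe _) ow) => i _.
apply/eqP; rewrite -subr_eq0; apply/negPn/negP => h; apply: no; by exists i.
Qed.

Definition bounded_by (S : H -> H) (s : R) := 0 < s /\ forall x, sqnorm (S x) <= s ^+ 2 * sqnorm x.

Lemma bounded_byP (S : H -> H) : hilbert_norm dot -> bounded_op S -> exists s, bounded_by S s.
Proof.
move=> dn /(bounded_opP dn) [s [s0 hs]]; exists (s + 1); split=> [|x]; first by rewrite ltr_wpDl.
apply: le_trans (hs x) _; rewrite ler_wpM2r ?sqnorm_ge0//; nra.
Qed.

Section OneOperator.
Variables (S : {linear H -> H}) (s : R).
Hypotheses (bS : bounded_by S s) (sS : selfadjoint dot S).

Lemma qformD x y : qform S (x + y) = qform S x + qform S y + 2 * Re (dot (S x) y).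
Proof. by rewrite /qform (raddfD S) /= !dotDl !dotDr !ReD (sS y x) (Re_dotC _ y); ring. Qed.
Lemma qformZ a x : qform S (a *: x) = sqn a * qform S x.
Proof.
rewrite /qform linearZ_LR dotZl dotZr mulrA sqnE.
by rewrite ReZ.
Qed.
Lemma qformN x : qform S (- x) = qform S x.
Proof. by rewrite /qform (raddfN S) /= dotNl dotNr opprK. Qed.

Lemma qform_le x : `|qform S x| <= s * sqnorm x.
Proof.
have [s0 hs] := bS; have si : 0 < s^-1 by rewrite invr_gt0.
have h1 := young dot (S x) x si; have h2 := young dot (- S x) x si.
have h3 := hs x; have h4 : s^-1 * sqnorm (S x) <= s * sqnorm x.
  rewrite -(ler_pM2l s0) !mulrA divff ?gt_eqF// mul1r; apply: le_trans h3 _.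
  by rewrite expr2.
rewrite sqnormN dotNl ReN invrK in h2; rewrite invrK in h1.
rewrite /qform ler_norml; apply/andP; split; lra.
Qed.

Definition ess_ge (g : R) := forall D w, orthofam D w ->
  exists y, [/\ sqnorm y = 1, forall i, (i < D)%N -> dot y (w i) = 0 & g <= qform S y].

(* The maximum of the essential spectrum, by ess_is_max. *)
Definition ess : R := sup [set g | ess_ge g].

Lemma ess_has_sup : has_sup [set g | ess_ge g].
Proof.
split.
  exists (- s) => D w /perp_unit [y [y1 yw]]; exists y; split=> //.
  by have := qform_le y; rewrite y1 mulr1 ler_norml => /andP[].
exists s => g /(_ 0%N (fun=> 0)) []// y [y1 _ gy].
by apply: le_trans gy _; have := qform_le y; rewrite y1 mulr1 ler_norml => /andP[].
Qed.

Lemma ess_lt g : g < ess -> ess_ge g.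
Proof.
move=> ge; have d0 : 0 < ess - g by rewrite subr_gt0.
have [g' hg'] := sup_adherent d0 ess_has_sup.
rewrite -/ess subKr => gg' D w ow; have [y [y1 yw gy]] := hg' D w ow.
by exists y; split=> //; apply: le_trans gy; exact: ltW.
Qed.

Lemma ess_gt r : ess < r -> exists D w, orthofam D w /\
  forall y, (forall i, (i < D)%N -> dot y (w i) = 0) -> qform S y <= r * sqnorm y.
Proof.
move=> er; have : ~ ess_ge r.
  move=> h; have : r <= ess by apply: sup_upper_bound => //; exact: ess_has_sup.
  by rewrite leNgt er.
move=> /existsNP [D /existsNP [w /not_implyP [ow no]]]; exists D, w; split=> // y yw.
have [->|y0] := eqVneq y 0; first by rewrite sqnorm0 mulr0 /qform (raddf0 S) /= dot0l.
have [a [z [yE [a0 [ay /(_ y0) z1]]]]] := normalizeE dot y.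
rewrite yE qformZ sqnormZ z1 mulr1 mulrC ler_wpM2r ?sqn_ge0//.
rewrite leNgt; apply/negP => rz; apply: no; exists z; split=> // [i iD|]; last exact: ltW.
have := yw i iD; rewrite yE dotZl => /eqP; rewrite mulf_eq0 => /orP[|/eqP//].
move=> /eqP az; move: y0; by rewrite yE az scale0r eqxx.
Qed.

(** The list may be arbitrary, so it can contain images S z as well; orthogonality to these removes
    cross terms of the form. *)
Lemma ess_ge_seq g (l : seq H) : g < ess ->
  exists y, [/\ sqnorm y = 1, forall z, z \in l -> dot y z = 0 & g <= qform S y].
Proof.
move=> /ess_lt h; have [D [w [ow wl]]] := gram_schmidt dot l.
have [y [y1 yw gy]] := h D w ow; exists y; split=> // z /wl ->.
exact: oproj_perp.
Qed.

(** On the complement of w the form is below some r0 < r. In the cross term between the complement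
    and the span of w, [young] lets the slack r - r0 pay for the former and C for the latter. *)
Lemma ess_bound r : ess < r -> exists D w C, [/\ orthofam D w, 0 <= C &
  forall x, qform S x <= r * sqnorm x + C * sqnorm (oproj D w x)].
Proof.
move=> er; pose r0 := (ess + r) / 2.
have [D [w [ow hw]]] : exists D w, orthofam D w /\
  forall y, (forall i, (i < D)%N -> dot y (w i) = 0) -> qform S y <= r0 * sqnorm y.
  by apply: ess_gt; rewrite /r0; lra.
have d0 : 0 < r - r0 by rewrite /r0; lra.
have [s0 hs] := bS; have di : 0 <= (r - r0)^-1 by rewrite invr_ge0 ltW.
(* Here s bounds the form on the span of w, the second term comes from the cross term, and |r|
   allows for a negative r. *)
exists D, w, (s + (r - r0)^-1 * s ^+ 2 + `|r|); split=> // [|x].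
  by rewrite !addr_ge0// ?mulr_ge0 ?sqr_ge0// ltW.
set f := oproj D w x; pose v := x - f.
have vw i : (i < D)%N -> dot v (w i) = 0 by move=> iD; rewrite oproj_res.
have xE : x = v + f by rewrite subrK.
have nx : sqnorm x = sqnorm v + sqnorm f by rewrite [in LHS]xE sqnormD oproj_perp//= mulr0 addr0.
have := hw v vw; have := qform_le f; rewrite ler_norml => /andP[_ h1] h2.
have h3 := young dot v (S f) d0; have h4 := hs f.
have h5 : (r - r0)^-1 * sqnorm (S f) <= (r - r0)^-1 * (s ^+ 2 * sqnorm f) by rewrite ler_wpM2l.
rewrite [in leLHS]xE qformD sS nx.
have h6 : - `|r| * sqnorm f <= r * sqnorm f.
  by rewrite ler_wpM2r ?sqnorm_ge0// lerNl; have := ler_norm (-r); rewrite normrN.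
lra.
Qed.

Lemma orthofam_sum_oproj k u D w : orthofam k u -> orthofam D w ->
  \sum_(i < k) sqnorm (oproj D w (u i)) <= D%:R.
Proof.
move=> ou ow; under eq_bigr do rewrite sqnorm_oproj//.
rewrite exchange_big -[leRHS]mulr_natl mulr1 -[D in leRHS]card_ord -sumr_const; apply: ler_sum => j _.
rewrite -[leRHS](orthofam_sqnorm ow (ltn_ord j)); apply: le_trans (bessel _ ou).
by apply: ler_sum => i _; rewrite sqn_dotC.
Qed.

(** The corrections in [ess_bound] add up to at most C D, however many vectors there are. *)
Lemma ess_sum_bound r : ess < r -> exists C, forall k u, orthofam k u ->
  \sum_(i < k) qform S (u i) <= r * k%:R + C.
Proof.
move=> /ess_bound [D [w [C [ow C0 hC]]]]; exists (C * D%:R) => k u ou.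
apply: (@le_trans _ _ (\sum_(i < k) (r * 1 + C * sqnorm (oproj D w (u i))))).
  by apply: ler_sum => i _; rewrite -(orthofam_sqnorm ou (ltn_ord i)).
rewrite big_split /= sumr_const card_ord mulr1 mulr_natr lerD2l -mulr_sumr.
by rewrite ler_wpM2l// orthofam_sum_oproj.
Qed.

(* On the complement of w the form of r - S is nonnegative, so the Cauchy-Schwarz
   inequality for it turns a small value of the form into a small norm. *)
Lemma weyl_vector (eta : R) k u : 0 < eta -> orthofam k u ->
  exists x, [/\ sqnorm x = 1, forall i, (i < k)%N -> dot x (u i) = 0 &
    sqnorm (S x - ess%:C *: x) <= eta].
Proof.
move=> eta0 ou; have [s0 hs] := bS.
pose b := `|ess| + 1 + s; have b0 : 0 < b by rewrite /b; have := normr_ge0 ess; lra.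
(* Chosen for the last estimate, 2 d^2 + 2 (2 d b) <= d (2 + 4 b) <= eta. *)
pose d := Num.min 1 (eta / (2 + 4 * b)).
have db : 0 < 2 + 4 * b by lra.
have d0 : 0 < d by rewrite lt_min ltr01 divr_gt0.
have d1 : d <= 1 by rewrite ge_min lexx.
have de : d * (2 + 4 * b) <= eta by rewrite -ler_pdivlMr// ge_min lexx orbT.
pose r := ess + d; have [D [w [ow hw]]] : exists D w, orthofam D w /\
  forall y, (forall i, (i < D)%N -> dot y (w i) = 0) -> qform S y <= r * sqnorm y.
  by apply: ess_gt; rewrite /r; lra.
(* Orthogonality to both w_i and S w_i makes B = (r - S) x orthogonal to w, so that [hw] applies to
   x - t B. *)
have [|x [x1 xl gx]] := @ess_ge_seq (ess - d)
  ([seq u i | i <- iota 0 k] ++ [seq w i | i <- iota 0 D] ++ [seq S (w i) | i <- iota 0 D]).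
  by lra.
have xu i : (i < k)%N -> dot x (u i) = 0.
  by move=> ik; apply: xl; rewrite mem_cat map_f ?mem_iota.
have xw i : (i < D)%N -> dot x (w i) = 0.
  by move=> iD; apply: xl; rewrite !mem_cat map_f ?orbT ?mem_iota.
have xSw i : (i < D)%N -> dot x (S (w i)) = 0.
  by move=> iD; apply: xl; rewrite !mem_cat (map_f (S \o w)) ?orbT ?mem_iota.
exists x; split=> //.
pose B := r%:C *: x - S x.
have Bw i : (i < D)%N -> dot B (w i) = 0.
  by move=> iD; rewrite /B dotBl dotZl sS xw// xSw// mulr0 subr0.
(* As b bounds the form of r - S, this t gives t^2 <(r - S) B, B> <= t |B|^2; nonnegativity at x - t
   B then leaves t |B|^2 <= <(r - S) x, x> <= 2 d. *)
pose t := b^-1; have t0 : 0 < t by rewrite invr_gt0.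
have h1 : qform S (x - t%:C *: B) <= r * sqnorm (x - t%:C *: B).
  by apply: hw => i iD; rewrite dotBl dotZl xw// Bw// mulr0 subr0.
have qB : `|qform S B| <= s * sqnorm B := qform_le B.
have rb : `|r| + s <= b.
  rewrite /b /r; have : `|ess + d| <= `|ess| + `|d| := ler_normD _ _.
  rewrite (ger0_norm (ltW d0)); lra.
have nB : sqnorm B = r * Re (dot x B) - Re (dot (S x) B).
  by rewrite /sqnorm {1}/B dotBl dotZl ReB ReZ.
move: h1; rewrite qformD sqnormB qformN qformZ sqnormZ sqn_real x1 !dotNr !dotZr conjc_real ReN !ReZ => h1.
have h2 : (r * sqnorm B - qform S B) <= b * sqnorm B.
  move: qB; rewrite ler_norml => /andP[h3 _]; have := ler_norm r; have := sqnorm_ge0 dot B => h4 h5.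
  have : (`|r| + s) * sqnorm B <= b * sqnorm B by rewrite ler_wpM2r.
  have : r * sqnorm B <= `|r| * sqnorm B by rewrite ler_wpM2r.
  lra.
have h3 : t ^+ 2 * (r * sqnorm B - qform S B) <= t ^+ 2 * (b * sqnorm B) by rewrite ler_wpM2l// sqr_ge0.
have tb : t ^+ 2 * (b * sqnorm B) = t * sqnorm B by rewrite /t; field; rewrite gt_eqF.
have h4 : t * sqnorm B <= 2 * d by move: h1 h3; rewrite tb nB /r; lra.
have h5 : sqnorm B <= 2 * d * b.
  by move: h4; rewrite /t mulrC ler_pdivrMr.
have -> : S x - ess%:C *: x = d%:C *: x - B.
  by rewrite /B /r RCD scalerDl opprB addrCA; congr (_ + _); rewrite opprD addrCA subrr addr0.
apply: le_trans (sqnormD_le _ _ _) _; rewrite sqnormN sqnormZ sqn_real x1.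
have : d ^+ 2 <= d by rewrite expr2 ler_piMr// ltW.
lra.
Qed.

End OneOperator.
End EssentialBound.

(** * The essential spectrum *)

Section Calkin.
Context {R : realType} {H : completeNormedModType R[i]}.
Variable dot : {dot H for Num.conj}.
Implicit Types (x y z : H) (u v w : nat -> H) (k D : nat).
Local Notation sqnorm := (sqnorm dot).
Local Notation orthofam := (orthofam dot).
Local Notation oproj := (oproj dot).
Local Notation qform := (qform dot).
Hypothesis dot_norm : hilbert_norm dot.

Lemma compact_oproj_comp (K : H -> H) (B : {linear H -> H}) D w (c b : R) : orthofam D w ->
  (forall x, sqnorm (B x) <= b ^+ 2 * sqnorm x) ->
  (forall x, K x = c%:C *: oproj D w (B x)) -> compact_op K.
Proof.
move=> ow hB KE; apply: (@finite_rank_compact _ _ dot dot_norm K D w (c ^+ 2 * b ^+ 2)) => x x1.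
exists (fun i => c%:C * dot (B x) (w i)); split=> [i iD|].
  rewrite sqnM sqn_real ler_wpM2l ?sqr_ge0//.
  apply: le_trans (CauchySchwarz_sqn _ _ _) _; rewrite (orthofam_sqnorm ow iD) mulr1.
  apply: le_trans (hB x) _; rewrite ler_piMr ?sqr_ge0//.
by rewrite KE scaler_sumr; apply: eq_bigr => i _; rewrite scalerA.
Qed.

(** The finite rank term makes z (S - l) coercive, hence invertible, with inverse B say; then z B
    inverts S - l up to the finite rank errors c P B and c B P. The scalar z turns the form towards
    the positive reals. *)
Lemma calkin_unit_coercive (S : {linear H -> H}) (l z : R[i]) (c d s : R) D w :
  orthofam D w -> z != 0 -> 0 < d -> bounded_by dot S s ->
  (forall x, d * sqnorm x <= Re (dot (z *: (S x - l *: x) + c%:C *: oproj D w x) x)) ->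
  calkin_unit (S \- l \*: id).
Proof.
move=> ow z0 d0 [s0 hs] hA.
pose A : {linear H -> H} := (z \*: (S \- (l \*: idfun))) \+ (c%:C \*: oproj D w).
have bA x : sqnorm (A x) <= (2 * (sqn z * (2 * s ^+ 2 + 2 * sqn l)) + 2 * c ^+ 2) * sqnorm x.
  rewrite /A /=; apply: le_trans (sqnormD_le _ _ _) _; rewrite !sqnormZ sqn_real.
  rewrite [leRHS]mulrDl; apply: lerD.
    rewrite -!mulrA ler_wpM2l// ler_wpM2l ?sqn_ge0//.
    apply: le_trans (sqnormD_le _ _ _) _; rewrite sqnormN sqnormZ; have := hs x; lra.
  have h := bessel x ow; rewrite -sqnorm_oproj// in h.
  by rewrite -(mulrA 2) ler_wpM2l// ler_wpM2l ?sqr_ge0.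
have [B [bB BA AB]] := coercive_inv dot_norm d0 bA hA.
have [b [b0 hb]] := bounded_byP dot_norm bB.
pose T : {linear H -> H} := z \*: B.
exists T; split.
- apply/(bounded_opP dot_norm); exists (Num.sqrt (sqn z) * b); split=> [|x].
    by rewrite mulr_ge0 ?sqrtr_ge0// ltW.
  by rewrite /T /= sqnormZ exprMn sqr_sqrtr ?sqn_ge0// -mulrA ler_wpM2l ?sqn_ge0.
- apply: (@compact_oproj_comp _ B D w (- c) b) => // x; rewrite /T /=.
  have := AB x; rewrite /A /= => /(canRL (addrK _)) h.
  rewrite linearZ_LR scalerA [l * z]mulrC -scalerA -scalerBr h.
  by rewrite addrAC subrr add0r RCN scaleNr.
- apply: (@finite_rank_compact _ _ dot dot_norm _ D (B \o w) (c ^+ 2)) => x x1.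
  exists (fun i => (- c)%:C * dot x (w i)); split=> [i iD|].
    rewrite sqnM sqn_real sqrrN ler_piMr ?sqr_ge0//.
    by apply: le_trans (CauchySchwarz_sqn _ _ _) _; rewrite (orthofam_sqnorm ow iD) mulr1.
  rewrite /T /=; have := BA x; rewrite {1}/A /= => h.
  have : z *: B (S x - l *: x) + c%:C *: B (oproj D w x) = x.
    by rewrite -[RHS]h [RHS](raddfD B) /= !linearZ_LR.
  move=> /(canRL (addrK _)) ->; rewrite addrAC subrr add0r /oproj raddf_sum -scaleNr scaler_sumr.
  by apply: eq_bigr => i _; rewrite /= linearZ_LR RCN scalerA.
Qed.

Section Spectrum.
Variable e : nat -> H.
Hypothesis oe : forall k, orthofam k e.
Variables (S : {linear H -> H}) (s : R).
Hypotheses (bS : bounded_by dot S s) (sS : selfadjoint dot S).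
Local Notation ess := (ess dot S).

Lemma ess_spectrum_le l : ess_spectrum S l -> l <= ess%:C.
Proof.
move=> hl; have [s0 hs] := bS; rewrite lecE /=; apply/andP.
have dS x : dot (S x) x = (qform S x)%:C := selfadj_real x sS.
have Iml : Im l = 0.
  apply/eqP/negPn/negP => l0; apply: hl.
  have d0 : 0 < Im l ^+ 2 by rewrite exprn_even_gt0.
  (* For nonreal l the factor i Im l makes the real part of the form equal to (Im l)^2 |x|^2. *)
  apply: (@calkin_unit_coercive S l ('i%C * (Im l)%:C) 0 (Im l ^+ 2) s 0 (fun=> 0)) => //.
    by rewrite eq_complex /= !(mul0r, mulr0, mul1r, add0r, subr0, addr0) negb_and l0 orbT.
  move=> x; rewrite scale0r addr0 dotZl dotBl dotZl dS dotxx.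
  by case: (l) => a b /=; rewrite le_eqVlt; apply/orP; left; apply/eqP; ring.
split; first by rewrite Iml.
rewrite leNgt; apply/negP => ml; apply: hl.
(* For r strictly between, the form of l - S + C P_w is at least Re l - r. *)
pose r := (ess + Re l) / 2.
have [D [w [C [ow C0 hC]]]] : exists D w C, [/\ orthofam D w, 0 <= C &
  forall x, qform S x <= r * sqnorm x + C * sqnorm (oproj D w x)].
  by apply: (ess_bound oe bS sS); rewrite /r; lra.
have d0 : 0 < Re l - r by rewrite /r; lra.
apply: (calkin_unit_coercive (c := C) ow _ d0 bS (z := -1)) => [|x].
  by rewrite oppr_eq0 oner_eq0.
rewrite scaleN1r dotDl dotNl dotBl !dotZl dS dotxx ReD ReN ReB ReZ ReM Iml mul0r subr0 /=.
have -> : Re (dot (oproj D w x) x) = sqnorm (oproj D w x).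
  by rewrite -{1}(oproj_idem x ow) oproj_selfadj.
have := hC x; lra.
Qed.

(** Suppose that T inverts S - ess up to a compact K. An orthonormal sequence with small y_n = (S -
    ess) f_n satisfies f_n = T y_n - K f_n, so two of its terms come close to each other, which
    orthonormality forbids. *)
Lemma ess_in_spectrum : ess_spectrum S ess%:C.
Proof.
move=> [T [bT _ cK]]; have [t [t0 ht]] := bounded_byP dot_norm bT.
pose y x := S x - ess%:C *: x.
(* Gives |T y_n|^2 <= 1/16; together with |K f_i - K f_j|^2 <= 1/4 this yields |f_i - f_j|^2 <= 1
   instead of 2. *)
have eta0 : 0 < (16 * t ^+ 2)^-1 by rewrite invr_gt0 mulr_gt0// exprn_gt0.
have [|||f [of_ _ hf]] := @orthofam_build _ _ dot
   (fun k u x => sqnorm (y x) <= (16 * t ^+ 2)^-1) 0 (fun=> 0).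
- by [].
- by [].
- by move=> k u _ ou; have [x [x1 xu hx]] := weyl_vector oe bS sS eta0 ou; exists x.
have f1 n : sqnorm (f n) <= 1 by rewrite (orthofam_sqnorm (of_ n.+1)).
have d0 : 0 < 4^-1 :> R by rewrite invr_gt0.
have [i [j [ij hij]]] := compact_op_close_values dot_norm cK f1 d0.
pose K := (T \o (S \- ess%:C \*: id)) \- id.
have fE n : f n = T (y (f n)) - K (f n) by rewrite /K /= subKr.
have : sqnorm (f i - f j) = 2.
  rewrite sqnormB (orthofam_sqnorm (of_ i.+1))// (orthofam_sqnorm (of_ j.+1))//.
  rewrite (of_ j.+1) ?(ltnW ij) ?ltnS ?(ltnW ij)//.
  by rewrite ltn_eqF//= mulr0 subr0.
have : sqnorm (f i - f j) <= 1; last by move=> h1 h2; move: h1; rewrite h2; lra.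
have -> : f i - f j = (T (y (f i)) - T (y (f j))) - (K (f i) - K (f j)).
  have gen (a b p q : H) : a - p - (b - q) = (a - b) - (p - q).
    by rewrite opprD addrACA -opprD.
  by rewrite -gen -!fE.
apply: le_trans (sqnormD_le _ _ _) _; rewrite sqnormN.
have := sqnormD_le dot (T (y (f i))) (- T (y (f j))); rewrite sqnormN.
have hT n : sqnorm (T (y (f n))) <= 16^-1.
  apply: le_trans (ht _) _; have := hf n isT; rewrite -(ler_pM2l (exprn_gt0 2 t0)) => h.
  apply: le_trans h _; rewrite invfM mulrCA divff ?mulr1// expf_neq0// gt_eqF//.
have := hT i; have := hT j; rewrite /K in hij *; lra.
Qed.

Lemma ess_is_max : is_max (ess_spectrum S) ess.
Proof. by split; [exact: ess_in_spectrum|exact: ess_spectrum_le]. Qed.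
End Spectrum.

Lemma ess_spectrumN (S : {linear H -> H}) (l : R[i]) :
  ess_spectrum (\- S) l -> ess_spectrum S (- l).
Proof.
move=> h [T [bT c1 c2]]; apply: h; exists (\- T); split.
- move: bT => [M hM]; exists M => x /=; by rewrite normrN.
- rewrite /calkin_eq (_ : _ \- _ = ((S \- - l \*: id) \o T) \- id)//.
  by apply/funext => x /=; rewrite raddfN /= scalerN scaleNr !opprK.
- rewrite /calkin_eq (_ : _ \- _ = (T \o (S \- - l \*: id)) \- id)//.
  by apply/funext => x /=; rewrite -(raddfN T) /= opprD scaleNr !opprK.
Qed.

Lemma is_max_min (S : {linear H -> H}) (M : R) :
  is_max (ess_spectrum (\- S)) M -> is_min (ess_spectrum S) (- M).
Proof.
move=> [hM hl]; split; first by rewrite RCN; exact: ess_spectrumN.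
move=> l Sl; rewrite RCN lerNl; apply: hl.
have : ess_spectrum (\- (\- S)) l by rewrite (_ : \- _ = S)//; apply/funext => x /=; rewrite opprK.
exact: (@ess_spectrumN (\- S)).
Qed.

End Calkin.

(** * Schur-Horn theorem for finitely many diagonal entries *)

Section RealSums.
Context {R : realType}.
Implicit Types (a c : nat -> R).

Definition antitone D a := forall i j, (i <= j)%N -> (j < D)%N -> a j <= a i.

Lemma sort_antitone a D : exists s t : nat -> nat,
  [/\ forall i, (i < D)%N -> (s i < D)%N, forall i, (i < D)%N -> (t i < D)%N,
      forall i, (i < D)%N -> s (t i) = i, forall i, (i < D)%N -> t (s i) = i & antitone D (a \o s)].
Proof.
pose r := sort (fun i j => a j <= a i) (iota 0 D).
have sr : size r = D by rewrite size_sort size_iota.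
have ur : uniq r by rewrite sort_uniq iota_uniq.
have mr i : (i \in r) = (i < D)%N by rewrite mem_sort mem_iota.
exists (nth 0%N r), (index^~ r); split=> [i iD|i iD|i iD|i iD|i j ij jD].
- by rewrite -mr mem_nth// sr.
- by rewrite -sr index_mem mr.
- by rewrite nth_index// mr.
- by rewrite index_uniq// sr.
- have tot : total (fun i j => a j <= a i) by move=> x y; exact: le_total.
  have tr : transitive (fun i j => a j <= a i) by move=> x y z h1 h2; exact: le_trans h2 h1.
  have := sorted_leq_nth tr (fun x => lexx (a x)) 0%N (sort_sorted tot (iota 0 D)).
  by rewrite -/r => /(_ i j); rewrite !inE sr; apply=> //; exact: leq_ltn_trans jD.
Qed.

(** Shifting by the k-th largest value m makes the terms before k nonnegative and the others
    nonpositive, so the best weights are 1 before k and 0 after; total weight k makes the shift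
    cancel. *)
Lemma kyfan_sum a (p : nat -> R) D k : antitone D a -> (k <= D)%N ->
  (forall j, (j < D)%N -> 0 <= p j <= 1) -> \sum_(j < D) p j = k%:R ->
  \sum_(j < D) a j * p j <= \sum_(j < k) a j.
Proof.
(* For k = 0 the predecessor is 0 and m the largest value, so all terms are nonpositive. *)
move=> aa kD p01 sp; pose m := a k.-1.
have : \sum_(j < D) (a j - m) * p j <= \sum_(j < k) (a j - m).
  rewrite -(big_mkord xpredT (fun j => (a j - m) * p j)) (big_cat_nat _ kD)//=.
  rewrite -(big_mkord xpredT (fun j => a j - m)) -[leRHS]addr0; apply: lerD.
    rewrite !big_nat; apply: ler_sum => j /= jk; have /p01/andP[p0 p1] := leq_trans jk kD.
    rewrite ler_piMr// subr_ge0; apply: aa; last by lia.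
    by rewrite -ltnS prednK//; apply: leq_ltn_trans jk.
  rewrite big_nat; apply: sumr_le0 => j /andP[kj jD]; have /andP[p0 p1] := p01 j jD.
  by rewrite mulr_le0_ge0// subr_le0; apply: aa => //; exact: leq_trans (leq_pred k) kj.
under eq_bigr do rewrite mulrBl.
by rewrite !sumrB -mulr_sumr sp sumr_const card_ord mulr_natr lerD2r.
Qed.

Lemma rotation (a b c : R) : b <= c <= a ->
  exists s t : R, s ^+ 2 + t ^+ 2 = 1 /\ s ^+ 2 * a + t ^+ 2 * b = c.
Proof.
move=> /andP[bc ca]; have [ab|ab] := eqVneq a b.
  exists 1, 0; rewrite expr1n expr0n /=; split; first by rewrite addr0.
  by move: bc ca; rewrite ab => h1 h2; lra.
have ab0 : 0 < a - b by rewrite subr_gt0 lt_neqAle eq_sym ab (le_trans bc).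
exists (Num.sqrt ((c - b) / (a - b))), (Num.sqrt ((a - c) / (a - b))).
rewrite !sqr_sqrtr ?divr_ge0 ?subr_ge0// ?(le_trans bc)//.
by split; field; rewrite gt_eqF.
Qed.

Lemma antitone_cross a (c0 : R) n : c0 <= a 0%N -> a n.+1 <= c0 ->
  exists j, [/\ (j <= n)%N, c0 <= a j & a j.+1 <= c0].
Proof.
elim: n => [|n IH] a0 an; first by exists 0%N.
have [h|h] := leP (a n.+1) c0.
  by have [j [jn ? ?]] := IH a0 h; exists j; split=> //; rewrite leqW.
by exists n.+1; split=> //; exact: ltW.
Qed.

(** The values left after c0 has been split off the pair a_j, a_{j+1} with the sum preserved;
    [bump j.+1] skips the index j + 1. *)
Definition merge_at a j (c0 : R) : nat -> R :=
  fun i => if i == j then a j + a j.+1 - c0 else a (bump j.+1 i).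

Lemma merge_at_sum a j (c0 : R) k : \sum_(i < k) merge_at a j c0 i =
  if (k <= j)%N then \sum_(i < k) a i else \sum_(i < k.+1) a i - c0.
Proof.
elim: k => [|k IH]; first by rewrite !big_ord0.
rewrite big_ord_recr /= IH /merge_at; case: (ltngtP k j) => [kj|jk|->].
- by rewrite big_ord_recr /= /bump leqNgt ltnS (ltnW kj).
- by rewrite [in RHS]big_ord_recr /= /bump jk add1n addrAC.
- by rewrite !big_ord_recr /= ; ring.
Qed.

Lemma merge_at_antitone a j (c0 : R) D : (j < D)%N -> antitone D.+1 a -> a j.+1 <= c0 <= a j ->
  antitone D (merge_at a j c0).
Proof.
move=> jD aa /andP[h1 h2] i k ik kD; rewrite /merge_at /bump.
have [ij|ij] := eqVneq i j; have [kj|kj] := eqVneq k j => //.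
- have -> : (j < k)%N by lia.
  have : a (1 + k)%N <= a j.+1 by apply: aa; lia.
  lra.
- have : a j <= a ((j < i) + i)%N by apply: aa; lia.
  lra.
- by apply: aa; lia.
Qed.

End RealSums.

Section FiniteSchurHorn.
Context {R : realType} {H : completeNormedModType R[i]}.
Variable dot : {dot H for Num.conj}.
Implicit Types (x y z : H) (u v w : nat -> H) (k D : nat) (a c : nat -> R).
Local Notation sqnorm := (sqnorm dot).
Local Notation orthofam := (orthofam dot).
Local Notation oproj := (oproj dot).
Local Notation qform := (qform dot).

(** The rotations in [schur_horn] have real coefficients; over real scalars the inner product and q
    obey the same rules in both arguments, without conjugates. *)
Definition real_bilinear (q : H -> H -> R[i]) :=
  (forall (s t : R) x y z, q (s%:C *: x + t%:C *: y) z = s%:C * q x z + t%:C * q y z) /\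
  (forall (s t : R) x y z, q z (s%:C *: x + t%:C *: y) = s%:C * q z x + t%:C * q z y).

Lemma dot_real_bilinear : real_bilinear dot.
Proof. by split=> s t x y z; rewrite ?dotDl ?dotDr ?dotZl ?dotZr ?conjc_real. Qed.

(* Schur-Horn, by induction on N: a vector with value c 0 is found in the span of
   two consecutive eigenvectors v j, v j.+1 with a j.+1 <= c 0 <= a j, and
   compressing q to its complement replaces a j, a j.+1 by a j + a j.+1 - c 0. *)
Lemma schur_horn (q : H -> H -> R[i]) (p N : nat) a c v (D := (N + p.+1)%N) :
  real_bilinear q -> orthofam D v ->
  (forall i j, (i < D)%N -> (j < D)%N -> q (v i) (v j) = (i == j)%:R * (a i)%:C) ->
  antitone D a -> antitone N c ->
  (forall k, (k <= N)%N -> \sum_(i < k) c i <= \sum_(i < k) a i) ->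
  (forall k, (k <= N)%N -> \sum_(i < D) a i - \sum_(i < k + p.+1) a i <=
                          \sum_(i < N) c i - \sum_(i < k) c i) ->
  exists f, [/\ orthofam N f, forall i, (i < N)%N -> q (f i) (f i) = (c i)%:C &
    forall x, (forall i, (i < D)%N -> dot x (v i) = 0) ->
      forall i, (i < N)%N -> dot x (f i) = 0].
Proof.
move=> [ql qr]; have [dl dr] := dot_real_bilinear.
rewrite {}/D; elim: N a c v => [|N IH] a c v; first by exists (fun=> 0); split.
move=> ov qv aa ac h1 h2.
have c0a : c 0%N <= a 0%N by have := h1 1%N isT; rewrite !big_ord1.
(* [h2] at k = N puts the last a below the last c, hence below c 0, so the a_i cross the level c
   0. *)
have [j [jN aj aj1]] : exists j, [/\ (j <= N + p)%N, c 0%N <= a j & a j.+1 <= c 0%N].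
  apply: antitone_cross => //.
  have := h2 N (leqnSn N); rewrite addSn !big_ord_recr /= addnS.
  rewrite [X in X <= _]addrAC subrr add0r addrAC subrr add0r => h.
  by apply: le_trans h _; apply: ac.
have jD : (j.+1 < N.+1 + p.+1)%N by rewrite addSn addnS.
have jD' : (j < N.+1 + p.+1)%N by rewrite ltnW.
have [s [t [st1 stc]]] := @rotation _ (a j) (a j.+1) (c 0%N) (introT andP (conj aj1 aj)).
have stC : s%:C * s%:C + t%:C * t%:C = 1 :> R[i] by rewrite -!RCM -RCD -!expr2 st1.
have stcC : s%:C * (s%:C * (a j)%:C) + t%:C * (t%:C * (a j.+1)%:C) = (c 0%N)%:C.
  by rewrite -!RCM -RCD -stc; congr (_%:C); ring.
(* f0 gets the value c 0, and g completes it to a basis of the plane, with the rest of the trace as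
   its value. The entry q f0 g disappears in the compression to [v']. *)
pose f0 := s%:C *: v j + t%:C *: v j.+1.
pose g := (- t)%:C *: v j + s%:C *: v j.+1.
pose v' i := if i == j then g else v (bump j.+1 i).
have jj1 : (j == j.+1) = false by rewrite ltn_eqF.
have j1j : (j.+1 == j) = false by rewrite gtn_eqF.
have bD i : (i < N + p.+1)%N -> (bump j.+1 i < N.+1 + p.+1)%N by rewrite /bump; lia.
have bj i : i != j -> (bump j.+1 i == j) = false /\ (bump j.+1 i == j.+1) = false.
  by move=> ij; split; apply/eqP; rewrite /bump; lia.
have bb i k : (bump j.+1 i == bump j.+1 k) = (i == k).
  by rewrite (inj_eq (can_inj (bumpK j.+1))).
have vv i k : (i < N.+1 + p.+1)%N -> (k < N.+1 + p.+1)%N -> dot (v i) (v k) = (i == k)%:R := @ov i k.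
have gg : dot g g = 1 by rewrite /g dl !dr !vv// !eqxx jj1 j1j !mulr1 !mulr0 !addr0 add0r RCN mulrNN addrC.
have ff : dot f0 f0 = 1 by rewrite /f0 dl !dr !vv// !eqxx jj1 j1j !mulr1 !mulr0 !addr0 add0r.
have fg : dot f0 g = 0.
  by rewrite /f0 /g dl !dr !vv// !eqxx jj1 j1j !mulr1 !mulr0 !addr0 add0r RCN mulrN addrC mulrC subrr.
have fv i : (i < N + p.+1)%N -> i != j -> dot f0 (v (bump j.+1 i)) = 0.
  move=> iD /bj [b1 b2]; rewrite /f0 dl !vv ?bD// ![_ == bump _ _]eq_sym b1 b2.
  by rewrite !mulr0 addr0.
have gv i : (i < N + p.+1)%N -> i != j -> dot g (v (bump j.+1 i)) = 0.
  move=> iD /bj [b1 b2]; rewrite /g dl !vv ?bD// ![_ == bump _ _]eq_sym b1 b2.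
  by rewrite !mulr0 addr0.
have qvv i k : (i < N.+1 + p.+1)%N -> (k < N.+1 + p.+1)%N ->
  q (v i) (v k) = (i == k)%:R * (a i)%:C := @qv i k.
have qgg : q g g = (a j + a j.+1 - c 0%N)%:C.
  rewrite /g ql !qr !qvv// !eqxx jj1 j1j !mul1r !mul0r !mulr0 !addr0 add0r -stc.
  rewrite -!RCM -RCD; congr (_%:C); move: st1 => st1'; have -> : s ^+ 2 = 1 - t ^+ 2 by lra.
  have : s * (s * a j.+1) = (1 - t ^+ 2) * a j.+1 by rewrite mulrA -expr2; congr (_ * _); lra.
  by move=> ->; ring.
have qff : q f0 f0 = (c 0%N)%:C.
  by rewrite /f0 ql !qr !qvv// !eqxx jj1 j1j !mul1r !mul0r !mulr0 !addr0 add0r.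
have qgv i : (i < N + p.+1)%N -> i != j -> q g (v (bump j.+1 i)) = 0.
  move=> iD /bj [b1 b2]; rewrite /g ql !qvv ?bD// ![_ == bump _ _]eq_sym b1 b2.
  by rewrite !mul0r !mulr0 addr0.
have qvg i : (i < N + p.+1)%N -> i != j -> q (v (bump j.+1 i)) g = 0.
  move=> iD /bj [b1 b2]; rewrite /g qr !qvv ?bD// b1 b2.
  by rewrite !mul0r !mulr0 addr0.
have v'j i : i != j -> v' i = v (bump j.+1 i) by rewrite /v' => /negbTE ->.
have v'jj : v' j = g by rewrite /v' eqxx.
have [||||||f [of_ fq pf]] := IH (merge_at a j (c 0%N)) (fun i => c i.+1) v'.
- move=> i k iD kD; have [->|ij] := eqVneq i j; have [->|kj] := eqVneq k j.
  + by rewrite v'jj gg.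
  + by rewrite v'jj v'j// gv.
  + by rewrite v'jj v'j// dotC gv// conjc0 (negbTE ij).
  + by rewrite !v'j// vv ?bD// bb.
- move=> i k iD kD; rewrite /merge_at; have [->|ij] := eqVneq i j; have [->|kj] := eqVneq k j.
  + by rewrite v'jj qgg ?eqxx mul1r.
  + by rewrite v'jj v'j// qgv// mul0r.
  + by rewrite v'jj v'j// qvg// (negbTE ij) mul0r.
  + by rewrite !v'j// qvv ?bD// bb.
- by apply: merge_at_antitone; rewrite ?aj1 ?aj//; lia.
- by move=> i k ik kN; apply: ac.
- move=> k kN; have := h1 k.+1 kN; rewrite merge_at_sum big_ord_recl /= => h3.
  (* If the merged place j is not reached, every a_i in the sum is at least a_j >= c 0, and the
     bound holds term by term. *)
  case: leqP => [kj|jk]; last by rewrite lerBrDl.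
  apply: ler_sum => i _; apply: (@le_trans _ _ (c 0%N)).
    by apply: ac => //; rewrite ltnS (leq_trans (ltn_ord i)).
  by apply: le_trans aj _; apply: aa => //; apply: leq_trans kj; exact: ltnW.
- move=> k kN; rewrite !merge_at_sum.
  have -> : (N + p.+1 <= j)%N = false by lia.
  have := h2 k.+1 kN; have := h2 0%N isT; rewrite big_ord0 subr0 !addSn add0n.
  rewrite [\sum_(i < N.+1) c i]big_ord_recl [\sum_(i < k.+1) c i]big_ord_recl /= => h3 h4.
  case: leqP => [kj|jk]; last first.
    by move: h4; rewrite /bump /=; lra.
  (* Term by term as above; subtracting this from the condition at k = 0 gives the claim. *)
  have h5 : \sum_(i < k) c i.+1 <= \sum_(i < k + p.+1) a i - \sum_(i < p.+1) a i.
    rewrite addnC big_split_ord /= addrAC subrr add0r; apply: ler_sum => i _.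
    apply: (@le_trans _ _ (c 0%N)); first by apply: ac => //; rewrite ltnS (leq_trans (ltn_ord i)).
    by apply: le_trans aj _; apply: aa => //; have := ltn_ord i; lia.
  move: h3; rewrite /bump /=; lra.
have fp i : (i < N)%N -> dot f0 (f i) = 0.
  apply: pf => k kD; have [->|kj] := eqVneq k j; first by rewrite v'jj.
  by rewrite v'j// fv.
exists (fun i => if i is i'.+1 then f i' else f0); split.
- move=> [|i] [|k] // iD kD; [exact: fp|rewrite dotC fp ?conjc0//|exact: of_].
- by move=> [|i] //; exact: fq.
- move=> x xv; have xg : dot x g = 0 by rewrite dr !xv// !mulr0 addr0.
  move=> [|i] iN; first by rewrite dr !xv// !mulr0 addr0.
  apply: pf => // k kD; have [->|kj] := eqVneq k j; first by rewrite v'jj.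
  by rewrite v'j// xv// bD.
Qed.

Section Compression.
Variable S : {linear H -> H}.
Hypothesis sS : selfadjoint dot S.

(** The spectral theorem for the Hermitian matrix of the compression of S to the span of w. Only the
    compression becomes diagonal: the v_i need not be eigenvectors of S. *)
Lemma diagonalize D w : orthofam D w -> exists v, [/\ orthofam D v,
  forall i j, (i < D)%N -> (j < D)%N -> dot (S (v i)) (v j) = (i == j)%:R * (qform S (v i))%:C,
  antitone D (fun i => qform S (v i)) &
  forall x, x = oproj D w x -> x = oproj D v x].
Proof.
move=> ow; pose A : 'M[R[i]]_D := \matrix_(i, j) dot (S (w i)) (w j).
have Ah : A \is hermsymmx.
  apply/is_hermitianmxP; rewrite expr0 scale1r; apply/matrixP => i j.
  by rewrite !mxE sS dotC.
have /orthomx_spectralP AE := hermitian_normalmx Ah.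
pose P := spectralmx A; have Pu : P \is unitarymx := spectral_unitarymx A.
rewrite -/P (invmx_unitary Pu) in AE.
set Q := (X in X *m _ *m _) in AE.
have PQ : P *m Q = 1%:M by apply/unitarymxP.
have QP : Q *m P = 1%:M := mulmx1C PQ.
have QE i j : Q i j = (P j i)^*%C by rewrite !mxE.
have PAQ : P *m A *m Q = diag_mx (spectral_diag A).
  by rewrite {1}AE !mulmxA PQ mul1mx -mulmxA PQ mulmx1.
pose v i : H := oapp (fun i : 'I_D => \sum_(j < D) P i j *: w j) 0 (insub i).
have vE (i : 'I_D) : v i = \sum_(j < D) P i j *: w j by rewrite /v valK.
have dwv (j i : 'I_D) : dot (w j) (v i) = Q j i.
  rewrite vE dot_sumr (bigD1 j) //= dotZr ow// eqxx mulr1 QE big1 ?addr0// => k kj.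
  by rewrite dotZr ow// eq_sym val_eqE (negbTE kj) mulr0.
have ov : orthofam D v.
  move=> i j iD jD; rewrite (vE (Ordinal iD)) dot_suml.
  under eq_bigr => k _ do rewrite dotZl (dwv k (Ordinal jD)).
  by have := congr1 (fun M : 'M[R[i]]_D => M (Ordinal iD) (Ordinal jD)) PQ; rewrite !mxE.
have vd (i j : 'I_D) : i != j -> dot (S (v i)) (v j) = 0.
  move=> ij; have := congr1 (fun M : 'M[R[i]]_D => M i j) PAQ.
  rewrite [in X in _ = X -> _]mxE (negbTE ij) mulr0n => <-.
  rewrite [in LHS]vE raddf_sum dot_suml -mulmxA mxE; apply: eq_bigr => k _.
  rewrite /= linearZ_LR dotZl; congr (_ * _).
  rewrite vE dot_sumr mxE; apply: eq_bigr => l _.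
  by rewrite dotZr mulrC mxE QE.
have dg i j : (i < D)%N -> (j < D)%N -> dot (S (v i)) (v j) = (i == j)%:R * (qform S (v i))%:C.
  move=> iD jD; have [<-|ij] := eqVneq i j; first by rewrite mul1r selfadj_real.
  by rewrite mul0r (vd (Ordinal iD) (Ordinal jD)).
have wv x : x = oproj D w x -> x = oproj D v x.
  move=> xE; rewrite {2}xE oproj_comp// => j jD.
  rewrite /oproj; pose j' := Ordinal jD.
  under eq_bigr => i _ do rewrite (dwv j') vE scaler_sumr.
  have h (l : 'I_D) : \sum_(i < D) Q j' i *: (P i l *: w l) = (j' == l)%:R *: w l.
    under eq_bigr => i _ do rewrite scalerA.
    rewrite -scaler_suml; have := congr1 (fun M : 'M[R[i]]_D => M j' l) QP.
    by rewrite !mxE => ->.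
  rewrite exchange_big /=; under eq_bigr => l _ do rewrite h.
  rewrite (bigD1 j') //= eqxx scale1r big1 ?addr0// => l lj.
  by rewrite eq_sym (negbTE lj) scale0r.
have [s [t [sD tD st ts aa]]] := sort_antitone (fun i => qform S (v i)) D.
have sinj i j : (i < D)%N -> (j < D)%N -> (s i == s j) = (i == j).
  by move=> iD jD; apply/eqP/eqP => [h|->//]; rewrite -(ts i)// h ts.
have os : orthofam D (v \o s) by move=> i j iD jD /=; rewrite ov ?sD// sinj.
exists (v \o s); split=> //.
  by move=> i j iD jD /=; rewrite dg ?sD// sinj.
move=> x /wv xE; rewrite {2}xE oproj_comp// => j jD.
by have /= := oproj_id os (tD j jD); rewrite st.
Qed.

Lemma qform_oproj D v x : orthofam D v ->
  (forall i j, (i < D)%N -> (j < D)%N -> dot (S (v i)) (v j) = (i == j)%:R * (qform S (v i))%:C) ->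
  x = oproj D v x -> qform S x = \sum_(j < D) qform S (v j) * sqn (dot x (v j)).
Proof.
move=> ov dg xE; apply: complexI; rewrite -selfadj_real// {1}xE raddf_sum dot_suml RC_sum.
apply: eq_bigr => i _; rewrite /= linearZ_LR dotZl xE dot_oprojr (bigD1 i) //= big1 => [|j ji].
  by rewrite dg// eqxx mul1r addr0 -xE [dot (v i) x]dotC RCM -sqnE; ring.
by rewrite dg// eq_sym val_eqE (negbTE ji) !mul0r.
Qed.

(** Ky Fan's maximum principle: the weights sum_i |<u_i, v_j>|^2 lie in [0, 1] by Bessel and add up
    to k. *)
Lemma kyfan D v k u : orthofam D v ->
  (forall i j, (i < D)%N -> (j < D)%N -> dot (S (v i)) (v j) = (i == j)%:R * (qform S (v i))%:C) ->
  antitone D (fun i => qform S (v i)) -> (k <= D)%N ->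
  orthofam k u -> (forall i, (i < k)%N -> u i = oproj D v (u i)) ->
  \sum_(i < k) qform S (u i) <= \sum_(i < k) qform S (v i).
Proof.
move=> ov dg aa kD ou uv.
have -> : \sum_(i < k) qform S (u i) = \sum_(j < D) qform S (v j) * \sum_(i < k) sqn (dot (u i) (v j)).
  under [RHS]eq_bigr do rewrite mulr_sumr.
  by rewrite exchange_big; apply: eq_bigr => i _; exact: qform_oproj (uv i _).
apply: (@kyfan_sum _ (fun i => qform S (v i))
  (fun j => \sum_(i < k) sqn (dot (u i) (v j))) D k) => // [j jD|].
  rewrite sumr_ge0 => [|i _]; last exact: sqn_ge0.
  rewrite -(orthofam_sqnorm ov jD); apply: le_trans (bessel _ ou).
  by apply: ler_sum => i _; rewrite sqn_dotC.
rewrite exchange_big /= -[RHS]mulr_natl mulr1 -[k in RHS]card_ord -sumr_const; apply: eq_bigr => i _.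
by rewrite -sqnorm_oproj// -uv// (orthofam_sqnorm ou).
Qed.
End Compression.
End FiniteSchurHorn.

Section FiniteDiagonal.
Context {R : realType} {H : completeNormedModType R[i]}.
Variable dot : {dot H for Num.conj}.
Implicit Types (x y z : H) (u v w : nat -> H) (k D : nat) (a c : nat -> R).
Local Notation sqnorm := (sqnorm dot).
Local Notation orthofam := (orthofam dot).
Local Notation oproj := (oproj dot).
Local Notation qform := (qform dot).

(* U_k(c) <= U_k(S) for all k, with both suprema unfolded. *)
Definition submajorized c (S : H -> H) := forall k (g : nat -> nat) (eps : R), 0 < eps ->
  (forall i j, (i < k)%N -> (j < k)%N -> g i = g j -> i = j) ->
  exists u, orthofam k u /\ \sum_(i < k) c (g i) <= \sum_(i < k) qform S (u i) + eps.

Lemma qform_opp (S : H -> H) x : qform (\- S) x = - qform S x.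
Proof. by rewrite /qform /= dotNl ReN. Qed.

Lemma sum_rev a D k : (k <= D)%N ->
  \sum_(i < k) a (D - i.+1)%N = \sum_(i < D) a i - \sum_(i < D - k) a i.
Proof.
elim: k => [|k IH] kD; first by rewrite big_ord0 subn0 subrr.
rewrite big_ord_recr /= IH ?(ltnW kD)//.
have -> : (D - k = (D - k.+1).+1)%N by rewrite subnSK.
by rewrite big_ord_recr /=; ring.
Qed.

(** The added form, eps (|<z, x>|^2 - |<z, y>|^2), is a difference of two numbers in [0, eps]. *)
Lemma qform_perturb (S : {linear H -> H}) (eps : R) x y z :
  0 < eps -> sqnorm x = 1 -> sqnorm y = 1 -> sqnorm z = 1 ->
  `|qform S z - Re (dot (S z) z + eps%:C * (dot z x * dot x z - dot z y * dot y z))| <= eps.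
Proof.
move=> e0 x1 y1 z1; have hx := CauchySchwarz_sqn dot z x; have hy := CauchySchwarz_sqn dot z y.
have := sqn_ge0 (dot z x); have := sqn_ge0 (dot z y).
move: hx hy; rewrite x1 y1 z1 mulr1 (dotC _ x z) (dotC _ y z) !sqnE -RCB -RCM ReD /= /qform => *.
rewrite ler_norml; apply/andP; split; nra.
Qed.

Variable e : nat -> H.
Hypothesis oe : forall k, orthofam k e.
Variable S : {linear H -> H}.
Hypothesis sS : selfadjoint dot S.

(** S is compressed to a space containing, for every k <= N, families nearly matching the k largest
    and the k smallest entries; by [kyfan] the eigenvalues of the compression satisfy both
    majorizations up to eps. *)
Lemma finite_diagonal c N (eps : R) : 0 < eps ->
  submajorized c S -> submajorized (fun n => - c n) (\- S) ->
  exists f, orthofam N f /\ forall i, (i < N)%N -> `|qform S (f i) - c i| <= eps.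
Proof.
move=> e0 cS cNS.
have [s [t [sN tN st ts ac]]] := sort_antitone c N.
have sinj i j : (i < N)%N -> (j < N)%N -> s i = s j -> i = j.
  by move=> iN jN h; rewrite -(ts i)// h ts.
have tinj i j : (i < N)%N -> (j < N)%N -> t i = t j -> i = j.
  by move=> iN jN h; rewrite -(st i)// h st.
have /choice [ut utP] : forall k, exists u, (k <= N)%N -> orthofam k u /\
    \sum_(i < k) c (s i) <= \sum_(i < k) qform S (u i) + eps.
  move=> k; case: (leqP k N) => kN; last by exists (fun=> 0).
  have [|u hu] := cS k s eps e0; last by exists u.
  by move=> i j ik jk; apply: sinj; exact: leq_trans kN.
have /choice [ub ubP] : forall k, exists u, (k <= N)%N -> orthofam k u /\
    \sum_(i < k) - c (s (N - i.+1)%N) <= \sum_(i < k) qform (\- S) (u i) + eps.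
  move=> k; case: (leqP k N) => kN; last by exists (fun=> 0).
  (* Counting from the end takes the k smallest entries. *)
  have [|u hu] := cNS k (fun i => s (N - i.+1)%N) eps e0; last by exists u.
  by move=> i j ik jk /sinj h; have := h ltac:(lia) ltac:(lia); lia.
(* The vectors e_0, ..., e_N force D > N, as [schur_horn] demands. *)
have [D [w [ow wl]]] := gram_schmidt dot
  ([seq ut k i | k <- iota 0 N.+1, i <- iota 0 N.+1] ++
   [seq ub k i | k <- iota 0 N.+1, i <- iota 0 N.+1] ++ [seq e i | i <- iota 0 N.+1]).
have utw k i : (i < k)%N -> (k <= N)%N -> ut k i = oproj D w (ut k i).
  move=> ik kN; apply: wl; rewrite mem_cat; apply/orP; left; apply: allpairs_f; rewrite mem_iota; lia.
have ubw k i : (i < k)%N -> (k <= N)%N -> ub k i = oproj D w (ub k i).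
  move=> ik kN; apply: wl; rewrite mem_cat; apply/orP; right; rewrite mem_cat; apply/orP; left.
  by apply: allpairs_f; rewrite mem_iota; lia.
have ND : (N < D)%N.
  apply: (orthofam_dim_le (@oe N.+1) ow) => i iN; apply: wl.
  by rewrite mem_cat; apply/orP; right; rewrite mem_cat; apply/orP; right; apply: map_f; rewrite mem_iota.
have [v [ov dg aa vw]] := diagonalize sS ow.
have [p DE] : exists p, D = (N + p.+1)%N by exists (D - N).-1; lia.
pose a i := qform S (v i).
have top k : (k <= N)%N -> \sum_(i < k) c (s i) <= \sum_(i < k) a i + eps.
  move=> kN; have [ou hu] := utP k kN; apply: le_trans hu _; rewrite lerD2r.
  apply: (kyfan sS ov dg aa _ ou); first by lia.
  by move=> i ik; apply: vw; exact: utw.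
have sNS : selfadjoint dot (\- S) by move=> x y; rewrite /= dotNl dotNr sS.
(* Reversed, the eigenbasis is in decreasing order for -S, and [kyfan] applies to the smallest
   eigenvalues. *)
pose v1 i := v (D - i.+1)%N.
have bot k : (k <= N)%N -> \sum_(i < D) a i - \sum_(i < D - k) a i <=
     \sum_(i < N) c (s i) - \sum_(i < N - k) c (s i) + eps.
  move=> kN; have [ou hu] := ubP k kN.
  have ov1 : orthofam D v1 by move=> i j iD jD; rewrite ov; [congr (_%:R); lia|lia|lia].
  have dg1 i j : (i < D)%N -> (j < D)%N ->
      dot ((\- S) (v1 i)) (v1 j) = (i == j)%:R * (qform (\- S) (v1 i))%:C.
    move=> iD jD; rewrite /= dotNl qform_opp RCN mulrN dg; [|lia|lia].
    by congr (- (_%:R * _)); lia.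
  have aa1 : antitone D (fun i => qform (\- S) (v1 i)).
    by move=> i j ij jD; rewrite !qform_opp lerN2; apply: aa; lia.
  have : \sum_(i < k) qform (\- S) (ub k i) <= \sum_(i < k) qform (\- S) (v1 i).
    apply: (kyfan (S := \- S) sNS ov1 dg1 aa1 _ ou); first by lia.
    move=> i ik; have {1}-> := vw _ (ubw k i ik kN); rewrite [RHS](_ : _ = oproj D v (ub k i)) //.
    rewrite /oproj /v1 -(big_mkord xpredT (fun j => dot (ub k i) (v (D - j.+1)%N) *: v (D - j.+1)%N)).
    rewrite big_nat_rev /= big_mkord; apply: eq_bigr => j _.
    by have -> : (D - (0 + D - j.+1).+1 = j)%N by have := ltn_ord j; lia.
  move: hu; rewrite sumrN (sum_rev (fun i => c (s i)))//.
  under [X in _ -> _ <= X -> _]eq_bigr do rewrite qform_opp.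
  rewrite sumrN (sum_rev a); [lra|lia].
(* Moving the two extreme eigenvalues apart by eps makes the majorization exact. *)
pose a1 i := a i + (i == 0%N)%:R * eps - (i == D.-1)%:R * eps.
have a1S k : \sum_(i < k) a1 i = \sum_(i < k) a i + (0 < k)%N%:R * eps - (D <= k)%N%:R * eps.
  elim: k => [|k IH].
    by rewrite !big_ord0 (_ : (D <= 0)%N = false) ?mul0r ?subr0 ?addr0//; lia.
  rewrite !big_ord_recr /= IH /a1.
  have -> : (D <= k.+1)%N%:R = (D <= k)%N%:R + (k == D.-1)%:R :> R.
    by rewrite -natrD; congr (_%:R); lia.
  have -> : (0 < k)%N%:R = 1 - (k == 0%N)%:R :> R by case: (k) => [|n] /=; rewrite ?subrr ?subr0.
  ring.
pose q x y := dot (S x) y + eps%:C *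
  (dot x (v 0%N) * dot (v 0%N) y - dot x (v D.-1) * dot (v D.-1) y).
have qb : real_bilinear q.
  split=> r1 r2 x y z; rewrite /q.
    rewrite (raddfD S) /= !(linearZ_LR S) !dotDl !dotZl.
    ring.
  by rewrite !dotDr !dotZr !conjc_real; ring.
have D0 : (0 < D)%N by lia.
have D1 : (D.-1 < D)%N by lia.
have qv i j : (i < D)%N -> (j < D)%N -> q (v i) (v j) = (i == j)%:R * (a1 i)%:C.
  move=> iD jD; rewrite /q dg// !ov// /a1 -/(a i).
  have -> : (i == 0%N)%:R * (0%N == j)%:R = (i == j)%:R * (i == 0%N)%:R :> R[i].
    by rewrite -!natrM; congr (_%:R); lia.
  have -> : (i == D.-1)%:R * (D.-1 == j)%:R = (i == j)%:R * (i == D.-1)%:R :> R[i].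
    by rewrite -!natrM; congr (_%:R); lia.
  by rewrite RCB RCD !RCM !rmorph_nat; ring.
have aa1 : antitone D a1.
  move=> i j ij jD; have := aa i j ij jD; rewrite -/(a i) -/(a j) /a1.
  have h1 : (j == 0%N)%:R * eps <= (i == 0%N)%:R * eps.
    by apply: (ler_wpM2r (ltW e0)); rewrite ler_nat; lia.
  have h2 : (i == D.-1)%:R * eps <= (j == D.-1)%:R * eps.
    by apply: (ler_wpM2r (ltW e0)); rewrite ler_nat; lia.
  lra.
rewrite DE in ov qv aa1.
have [k kN|k kN|f [of_ fq _]] := schur_horn qb ov qv aa1 ac.
- rewrite a1S; have -> : (D <= k)%N = false by lia.
  case: k kN => [|k] kN; first by rewrite !big_ord0 !mul0r addr0 subr0.
  by rewrite mul1r mul0r subr0; exact: top.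
(* For k = N both differences vanish; for smaller k the last eigenvalue, lowered by eps, is among
   those counted. *)
- rewrite -DE !a1S leqnn D0; have [->|kN'] := eqVneq k N.
    by rewrite -DE D0 leqnn !subrr.
  have := bot (N - k)%N (leq_subr _ _).
  have -> : (D - (N - k) = k + p.+1)%N by lia.
  have -> : (N - (N - k) = k)%N by lia.
  have -> : (D <= k + p.+1)%N = false by lia.
  have -> : (0 < k + p.+1)%N by lia.
  rewrite mul0r mul1r subr0; lra.
exists (f \o t); split=> [i j iN jN|i iN] /=.
  rewrite of_ ?tN//; congr (_%:R); congr nat_of_bool; apply/eqP/eqP => [|->//]; exact: tinj.
have h := fq (t i) (tN i iN); rewrite /= st// in h.
have -> : c i = Re (q (f (t i)) (f (t i))) by rewrite h.
rewrite -DE in ov.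
by apply: qform_perturb; rewrite ?(orthofam_sqnorm ov)// (orthofam_sqnorm of_)// tN.
Qed.
End FiniteDiagonal.

(** * Extension to an orthonormal basis *)

Section InfiniteDiagonal.
Context {R : realType} {H : completeNormedModType R[i]}.
Variable dot : {dot H for Num.conj}.
Implicit Types (x y z : H) (u v w : nat -> H) (k D : nat) (a c : nat -> R).
Local Notation sqnorm := (sqnorm dot).
Local Notation orthofam := (orthofam dot).
Local Notation oproj := (oproj dot).
Local Notation qform := (qform dot).
Local Notation submajorized := (submajorized dot).

(** With k + 1 = 2^i (2 n + 1), the exponent of 2 schedules every basis index i infinitely often. *)
Lemma logn2_visits i n : exists k, (n <= k)%N /\ logn 2 k.+1 = i.
Proof.
have p2 : (0 < 2 ^ i)%N by rewrite expn_gt0.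
exists (2 ^ i * n.*2.+1).-1; rewrite prednK ?muln_gt0 ?p2//; split; first by nia.
rewrite lognM// pfactorK// logn_coprime ?addn0//.
by rewrite coprime2n /= odd_double.
Qed.

Variable e : nat -> H.
Hypothesis oe : forall k, orthofam k e.
Variables (S : {linear H -> H}) (s : R).
Hypotheses (bS : bounded_by dot S s) (sS : selfadjoint dot S).

(** If infinitely many entries exceeded r, any k of them would sum to at least r k, while
    [ess_sum_bound] with an intermediate r' allows only r' k + C up to a fixed error. *)
Lemma submajorized_tail c r : submajorized c S -> ess dot S < r ->
  exists N, forall n, (N <= n)%N -> c n <= r.
Proof.
move=> cS er; apply: contrapT => /forallNP no.
have /choice [h hP] : forall N, exists n, (N <= n)%N /\ r < c n.
  move=> N; have := no N => /existsNP [n /not_implyP [Nn /negP]].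
  by rewrite -ltNge => cn; exists n.
pose g := fix g n := if n is m.+1 then h (g m).+1 else h 0%N.
have gr n : r < c (g n) by case: n => [|n] /=; [have [] := hP 0%N|have [] := hP (g n).+1].
have gm i j : (i < j)%N -> (g i < g j)%N.
  elim: j => // j IH; rewrite ltnS leq_eqVlt => /predU1P[->|/IH ij]; first by have [] := hP (g j).+1.
  by apply: ltn_trans ij _; have [] := hP (g j).+1.
have ginj i j : g i = g j -> i = j.
  by move=> gij; case: (ltngtP i j) => // /gm; rewrite gij ltnn.
pose r' := (ess dot S + r) / 2.
have [C hC] : exists C, forall k u, orthofam k u -> \sum_(i < k) qform S (u i) <= r' * k%:R + C.
  by apply: (ess_sum_bound oe bS sS); rewrite /r'; lra.
have rr : 0 < r - r' by rewrite /r'; lra.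
(* Then (r - r') k > C + 1, where 1 is the error taken in [submajorized]. *)
have [k hk] : exists k : nat, (C + 1) / (r - r') < k%:R.
  by exists (Num.truncn ((C + 1) / (r - r'))).+1; exact: truncnS_gt.
have [|u [ou hu]] := cS k g 1 ltr01; first by move=> i j _ _; exact: ginj.
have h1 : r * k%:R <= \sum_(i < k) c (g i).
  rewrite mulr_natr -[k in leLHS]card_ord -sumr_const; apply: ler_sum => i _; exact: ltW.
have := hC k u ou; move: hk; rewrite ltr_pdivrMr//; lra.
Qed.

(** y1 nearly attains the upper essential bound and y2 the lower one. As y2 is orthogonal to y1 and
    S y1, the form interpolates between its two values on their circle without cross terms. *)
Lemma approx_value (l : seq H) (g eps : R) : 0 < eps ->
  - ess dot (\- S) - eps <= g -> g <= ess dot S + eps ->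
  exists y, [/\ sqnorm y = 1, forall z, z \in l -> dot y z = 0 & `|qform S y - g| <= 2 * eps].
Proof.
move=> e0 g1 g2.
have bNS : bounded_by dot (\- S) s by have [s0 hs] := bS; split=> // x; rewrite /= sqnormN.
have [|y1 [y11 y1l gy1]] := @ess_ge_seq _ _ dot e oe S s bS (ess dot S - eps) l.
  by rewrite gtrDl oppr_lt0.
have [|y2 [y21 y2l gy2]] := @ess_ge_seq _ _ dot e oe (\- S) s bNS
  (ess dot (\- S) - eps) (y1 :: S y1 :: l).
  by rewrite gtrDl oppr_lt0.
rewrite qform_opp in gy2; move: (ess dot (\- S)) g1 gy2 => m g1 gy2.
have y21l z : z \in l -> dot y2 z = 0 by move=> zl; apply: y2l; rewrite !inE zl !orbT.
have [h1|h1] := ltP (qform S y1) g.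
  by exists y1; split=> //; rewrite ler_norml; apply/andP; split; lra.
have [h2|h2] := ltP g (qform S y2).
  by exists y2; split=> //; rewrite ler_norml; apply/andP; split; lra.
have [p [t [pt1 ptg]]] := @rotation _ (qform S y1) (qform S y2) g (introT andP (conj h2 h1)).
have d21 : dot y2 y1 = 0 by apply: y2l; rewrite !inE eqxx.
have dS : dot y2 (S y1) = 0 by apply: y2l; rewrite !inE eqxx orbT.
exists (p%:C *: y1 + t%:C *: y2); split.
- rewrite sqnormD !sqnormZ !sqn_real y11 y21 !mulr1 pt1 dotZl dotZr (dotC _ y1) d21 conjc0 !mulr0 /=.
  by rewrite addr0.
- by move=> z zl; rewrite dotDl !dotZl y1l// y21l// !mulr0 addr0.
- rewrite (qformD sS) !qformZ !sqn_real (linearZ_LR S) dotZl dotZr (dotC _ (S y1)) dS conjc0 !mulr0 /=.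
  by rewrite addr0 ptg subrr normr0 mulr_ge0// ltW.
Qed.

(* f is sqrt(1 - kap) y + sqrt(kap) z, where z is the normalized residual of x and
   <Sy, y> is close to g: a small kap hardly moves the diagonal entry, while the
   square of the residual of x shrinks by the factor 1 - kap. *)
Lemma absorb_step k u x (g eps kap : R) : orthofam k u -> 0 < eps -> 0 < kap < 1 ->
  kap * (s + `|g|) <= eps -> - ess dot (\- S) - eps <= g -> g <= ess dot S + eps ->
  exists f, [/\ sqnorm f = 1, forall i, (i < k)%N -> dot f (u i) = 0 &
    `|qform S f - g| <= 3 * eps /\ kap * sqnorm (x - oproj k u x) <= sqn (dot x f)].
Proof.
move=> ou e0 /andP[k0 k1] ke g1 g2; set r := x - _.
have [b [z [rE [b0 [br z1]]]]] := normalizeE dot r.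
(* Orthogonality to z and S z removes the cross terms from the norm and from the form of the tilted
   vector. *)
have [y [y1 yl yg]] := approx_value (z :: S z :: [seq u i | i <- iota 0 k]) e0 g1 g2.
have yz : dot y z = 0 by apply: yl; rewrite !inE eqxx.
have ySz : dot y (S z) = 0 by apply: yl; rewrite !inE eqxx orbT.
have yu i : (i < k)%N -> dot y (u i) = 0.
  by move=> ik; apply: yl; rewrite !inE map_f ?orbT// mem_iota.
have [r0|r0] := eqVneq r 0.
  exists y; split=> //; split; first by apply: le_trans yg _; lra.
  by rewrite r0 sqnorm0 mulr0 sqn_ge0.
have {}z1 := z1 r0; have bn0 : b != 0 by apply: contra r0 => /eqP h; rewrite rE h scale0r.
have zu i : (i < k)%N -> dot z (u i) = 0.
  move=> ik; have := oproj_res x ou ik; rewrite -/r rE dotZl => /eqP.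
  by rewrite mulf_eq0 => /orP[/eqP h|/eqP//]; case/eqP: bn0; exact: complexI h.
pose al := Num.sqrt (1 - kap); pose be := Num.sqrt kap.
have al2 : al ^+ 2 = 1 - kap by rewrite sqr_sqrtr// subr_ge0 ltW.
have be2 : be ^+ 2 = kap by rewrite sqr_sqrtr// ltW.
exists (al%:C *: y + be%:C *: z); split.
- rewrite sqnormD !sqnormZ !sqn_real y1 z1 dotZl dotZr yz !mulr0 /= al2 be2; ring.
- by move=> i ik; rewrite dotDl !dotZl yu// zu// !mulr0 addr0.
split.
  rewrite (qformD sS) !qformZ !sqn_real (linearZ_LR S) dotZl dotZr sS ySz !mulr0 /= addr0 al2 be2.
  have hz := qform_le bS z; rewrite z1 mulr1 in hz.
  have hg : kap * `|qform S z - g| <= eps.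
    apply: le_trans ke; rewrite (ler_wpM2l (ltW k0))//.
    by apply: le_trans (ler_normB _ _) _; rewrite lerD2r.
  rewrite (_ : _ - g = (1 - kap) * (qform S y - g) + kap * (qform S z - g)); last by ring.
  apply: le_trans (ler_normD _ _) _; rewrite !normrM (gtr0_norm k0).
  rewrite (gtr0_norm (x := 1 - kap)) ?subr_gt0//.
  have : (1 - kap) * `|qform S y - g| <= 1 * (2 * eps).
    by apply: ler_pM => //; rewrite ?subr_ge0 ?gerBl ltW.
  move: hg; move: (`|qform S y - g|) (`|qform S z - g|) => A B; lra.
have -> : dot x (al%:C *: y + be%:C *: z) = be%:C * b%:C.
  rewrite -(subrK (oproj k u x) x) -/r dotDl [dot (oproj k u x) _]dotC oproj_perp; last first.
    by move=> i ik; rewrite dotDl !dotZl yu// zu// !mulr0 addr0.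
  rewrite conjc0 addr0 rE dotDr !dotZr !dotZl !conjc_real.
  by rewrite (dotC _ z y) yz conjc0 dotxx z1 !mulr0 add0r mulr1.
by rewrite -RCM sqn_real exprMn be2 br.
Qed.

(** The squared residual of a fixed e_i never increases along f, and each visit multiplies it by at
    most 1 - kap. *)
Lemma diagonal_extension c N f0 (eps : R) : 0 < eps -> orthofam N f0 ->
  (exists G, forall n, `|c n| <= G) ->
  (forall n, (N <= n)%N -> - ess dot (\- S) - eps <= c n /\ c n <= ess dot S + eps) ->
  exists f, [/\ forall k, orthofam k f, forall i, (i < N)%N -> f i = f0 i,
    forall n, (N <= n)%N -> `|qform S (f n) - c n| <= 3 * eps &
    forall i (d : R), 0 < d -> exists n, sqnorm (e i - oproj n f (e i)) <= d].
Proof.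
move=> e0 of0 [G hG] hc; have [s0 _] := bS.
have G0 : 0 <= G by apply: le_trans (hG 0%N).
(* One angle for all n: the bound G of c gives kap (s + |c_n|) <= eps uniformly, and 1/2 keeps kap
   below 1. *)
pose kap := Num.min 2^-1 (eps / (s + G)).
have sG : 0 < s + G by rewrite ltr_wpDr.
have k0 : 0 < kap by rewrite lt_min invr_gt0 ltr0n divr_gt0.
have k2 : kap <= 2^-1 by rewrite ge_min lexx.
have k01 : 0 < kap < 1 by rewrite k0 /=; apply: le_lt_trans k2 _; rewrite invf_lt1 ?ltr0n// ltr1n.
have kG : kap * (s + G) <= eps by rewrite -ler_pdivlMr// ge_min lexx orbT.
pose j k := logn 2 k.+1.
pose Q k u z := `|qform S z - c k| <= 3 * eps /\
  kap * sqnorm (e (j k) - oproj k u (e (j k))) <= sqn (dot (e (j k)) z).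
have [k u u' z uu' []|k u Nk ou|f [of_ f_0 hf]] := orthofam_build (Q := Q) of0.
- move=> h1 h2; split=> //; rewrite (_ : oproj k u' _ = oproj k u (e (j k)))//.
  by apply: eq_bigr => i _; rewrite uu'.
- have [h1 h2] := hc k Nk; apply: absorb_step => //.
  by apply: le_trans kG; rewrite ler_wpM2l ?lerD2l// ltW.
exists f; split=> // [n Nn|i d d0]; first by have [] := hf n Nn.
pose a n := sqnorm (e i - oproj n f (e i)).
have aS n : a n.+1 = a n - sqn (dot (e i) (f n)) by rewrite /a !sqnorm_res// big_ord_recr /=; ring.
have am n m : (n <= m)%N -> a m <= a n.
  elim: m => [|m IH]; first by rewrite leqn0 => /eqP ->.
  rewrite leq_eqVlt => /predU1P[->//|nm]; apply: le_trans (IH nm).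
  by rewrite aS gerBl sqn_ge0.
have step m : exists n, a n <= sqnorm (e i) * (1 - kap) ^+ m.
  elim: m => [|m [n hn]].
    by exists 0%N; rewrite /a /oproj big_ord0 subr0 expr0 mulr1.
  have [k [nk jk]] := logn2_visits i (maxn n N).
  have [_] := hf k (leq_trans (leq_maxr _ _) nk); rewrite /j jk -/(a k) => h.
  exists k.+1; rewrite exprS mulrCA; apply: (@le_trans _ _ ((1 - kap) * a k)).
    by rewrite aS; lra.
  rewrite ler_wpM2l//; first by rewrite subr_ge0; case/andP: k01 => _ /ltW.
  by apply: le_trans hn; apply: am; apply: leq_trans nk; exact: leq_maxl.
have q01 : 0 <= 1 - kap < 1 by case/andP: k01 => h1 h2; apply/andP; split; lra.
have [M hM] := geometric_le (sqnorm (e i)) q01 d0.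
by have [n hn] := step M; exists n; apply: le_trans hn _; exact: hM.
Qed.
End InfiniteDiagonal.

(** * Unitaries from orthonormal bases *)

Section Transfer.
Context {R : realType} {H : completeNormedModType R[i]}.
Variable dot : {dot H for Num.conj}.
Implicit Types (x y z : H) (u v w e f : nat -> H) (k D : nat) (a c : nat -> R).
Local Notation sqnorm := (sqnorm dot).
Local Notation orthofam := (orthofam dot).
Local Notation oproj := (oproj dot).
Local Notation qform := (qform dot).
Hypothesis dot_norm : hilbert_norm dot.

Lemma small_eq0 (z : R[i]) (C : R) : (forall eps, 0 < eps -> sqn z <= eps * C) -> z = 0.
Proof.
move=> h; apply/eqP; rewrite -sqn_eq0 eq_le sqn_ge0 andbT.
apply/ler_addgt0Pr => eps e0; rewrite add0r.
have C0 : 0 < `|C| + 1 by rewrite ltr_wpDl.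
apply: le_trans (h _ (divr_gt0 e0 C0)) _; rewrite -mulrA ler_piMr ?(ltW e0)//.
rewrite mulrC ler_pdivrMr// mul1r; have := ler_norm C; lra.
Qed.

(** When z is orthogonal to f, replacing e_i by its residual does not change <z, e_i>, and the
    residuals are arbitrarily small. *)
Lemma total_of_approx e f : (forall k, orthofam k f) ->
  (forall z, (forall i, dot z (e i) = 0) -> z = 0) ->
  (forall i (d : R), 0 < d -> exists n, sqnorm (e i - oproj n f (e i)) <= d) ->
  forall z, (forall i, dot z (f i) = 0) -> z = 0.
Proof.
move=> of_ te ha z zf; apply: te => i; apply: (@small_eq0 _ (sqnorm z)) => eps e0.
have [n hn] := ha i eps e0.
have -> : dot z (e i) = dot z (e i - oproj n f (e i)).
  by rewrite dotBr oproj_perp ?subr0.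
by apply: le_trans (CauchySchwarz_sqn _ _ _) _; rewrite mulrC ler_wpM2r ?sqnorm_ge0.
Qed.

Lemma bessel_cauchy e x : (forall k, orthofam k e) -> forall eps : R, 0 < eps ->
  exists N, forall n m, (N <= n)%N -> (n <= m)%N ->
    \sum_(i < m) sqn (dot x (e i)) - \sum_(i < n) sqn (dot x (e i)) <= eps.
Proof.
move=> oe eps e0; pose sg n := \sum_(i < n) sqn (dot x (e i)).
have hs : has_sup (range sg).
  by split; [exists (sg 0%N); exists 0%N | exists (sqnorm x) => _ [n _ <-]; apply: bessel].
have [_ [N _ <-]] := sup_adherent e0 hs => hN.
exists N => n m Nn nm; rewrite -/(sg m) -/(sg n).
have : sg m <= sup (range sg) by apply: sup_upper_bound => //; exists m.
have : sg N <= sg n.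
  rewrite /sg -!(big_mkord xpredT (fun i => sqn (dot x (e i)))) (big_cat_nat _ Nn)//= lerDl.
  by apply: sumr_ge0 => i _; exact: sqn_ge0.
lra.
Qed.

Lemma sqnorm_comb f n m (a : nat -> R[i]) : orthofam m f -> (n <= m)%N ->
  sqnorm (\sum_(i < m) a i *: f i - \sum_(i < n) a i *: f i) =
  \sum_(i < m) sqn (a i) - \sum_(i < n) sqn (a i).
Proof.
elim: m => [|m IH] of_; first by rewrite leqn0 => /eqP ->; rewrite !big_ord0 !subrr sqnorm0.
rewrite leq_eqVlt => /predU1P[->|nm]; first by rewrite !subrr sqnorm0.
rewrite !big_ord_recr /= addrAC sqnormD IH; [|exact: orthofamW of_|by []].
rewrite sqnormZ (orthofam_sqnorm of_)// mulr1 addrAC.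
have d0 j : (j <= m)%N -> dot (\sum_(i < j) a i *: f i) (a m *: f m) = 0.
  move=> jm; rewrite dot_suml big1// => i _; have im := leq_trans (ltn_ord i) jm.
  by rewrite dotZl dotZr of_// ?(ltn_eqF im) ?mulr0// ltnW.
by rewrite dotBl !d0// subrr /=; ring.
Qed.

Lemma dot_comb f n (a : nat -> R[i]) j : orthofam n f -> (j < n)%N ->
  dot (\sum_(i < n) a i *: f i) (f j) = a j.
Proof.
move=> of_ jn; rewrite dot_suml (bigD1 (Ordinal jn)) //= dotZl of_// eqxx mulr1.
rewrite big1 ?addr0// => i ij; rewrite dotZl of_//.
by move: ij; rewrite -val_eqE /= => /negbTE ->; rewrite mulr0.
Qed.

(** T x is the sum of <x, e_i> f_i, convergent by Bessel. Linearity is read off the coefficients,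
    which determine a vector because f is total. *)
Lemma transfer e f : (forall k, orthofam k e) -> (forall k, orthofam k f) ->
  (forall z, (forall i, dot z (f i) = 0) -> z = 0) ->
  exists T : {linear H -> H},
    (forall x i, dot (T x) (f i) = dot x (e i)) /\ forall x, sqnorm (T x) <= sqnorm x.
Proof.
move=> oe of_ tf; pose P x n := \sum_(i < n) dot x (e i) *: f i.
have /choice [T TP] : forall x, exists y, forall eps : R, 0 < eps ->
    exists N, forall n, (N <= n)%N -> sqnorm (y - P x n) <= eps.
  move=> x; apply: (cauchy_sqnorm dot_norm) => eps e0; have [N hN] := bessel_cauchy x oe e0.
  exists N => m n Nm Nn; case: (leqP n m) => nm.
    by rewrite /P (sqnorm_comb (fun i => dot x (e i)) (of_ m))// hN.
  by rewrite -sqnormN opprB /P (sqnorm_comb (fun i => dot x (e i)) (of_ n)) ?hN// ltnW.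
have Tf x i : dot (T x) (f i) = dot x (e i).
  apply/eqP; rewrite -subr_eq0; apply/eqP; apply: (@small_eq0 _ 1) => eps e0.
  have [N hN] := TP x eps e0; pose n := maxn N i.+1.
  have <- : dot (P x n) (f i) = dot x (e i).
    by apply: (dot_comb (fun i => dot x (e i)) (of_ n)); exact: leq_maxr.
  rewrite -dotBl; apply: le_trans (CauchySchwarz_sqn _ _ _) _.
  by rewrite (orthofam_sqnorm (of_ i.+1))// !mulr1 hN// leq_maxl.
have Tlin : linear T.
  move=> a x y; apply/eqP; rewrite -subr_eq0; apply/eqP; apply: tf => i.
  by rewrite dotBl dotDl dotZl !Tf dotDl dotZl subrr.
pose T' : {linear H -> H} := HB.pack T (GRing.isLinear.Build R[i] H H _ T Tlin).
exists T'; split=> // x; apply/ler_addgt0Pr => eps e0.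
have [N hN] := TP x eps e0; have := hN N (leqnn N).
have PE : P x N = oproj N f (T x) by apply: eq_bigr => i _; rewrite Tf.
rewrite PE sqnorm_res//; under eq_bigr do rewrite Tf.
have := bessel x (oe N); rewrite /T' /=; lra.
Qed.

(** The transfers in the two directions invert each other, and mutually inverse contractions are
    isometries. *)
Lemma unitary_transfer e f : (forall k, orthofam k e) -> (forall k, orthofam k f) ->
  (forall z, (forall i, dot z (e i) = 0) -> z = 0) ->
  (forall z, (forall i, dot z (f i) = 0) -> z = 0) ->
  exists U W : {linear H -> H}, unitary_with_adjoint dot U W /\ forall i, U (e i) = f i.
Proof.
move=> oe of_ te tf.
have [U [Uf Ub]] := transfer oe of_ tf; have [W [We Wb]] := transfer of_ oe te.
have ext (g : nat -> H) (tg : forall z, (forall i, dot z (g i) = 0) -> z = 0) x y :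
    (forall i, dot x (g i) = dot y (g i)) -> x = y.
  by move=> h; apply/eqP; rewrite -subr_eq0; apply/eqP/tg => i; rewrite dotBl h subrr.
have WU x : W (U x) = x by apply: (ext _ te) => i; rewrite We Uf.
have UW x : U (W x) = x by apply: (ext _ tf) => i; rewrite Uf We.
have Un x : sqnorm (U x) = sqnorm x.
  by apply/eqP; rewrite eq_le Ub /= -{1}(WU x) Wb.
(* Polarization: x + y yields the real part, and i x then the imaginary part. *)
have Ur x y : Re (dot (U x) (U y)) = Re (dot x y).
  have := Un (x + y); rewrite raddfD /= !sqnormD !Un; lra.
have Ud x y : dot (U x) (U y) = dot x y.
  have := Ur ('i%C *: x) y; rewrite linearZ_LR !dotZl !ReM /= => h.
  apply/eqP; rewrite eq_complex Ur eqxx /=; apply/eqP; lra.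
exists U, W; split.
  split.
  - by apply/(bounded_opP dot_norm); exists 1; split=> // x; rewrite expr1n mul1r.
  - by apply/(bounded_opP dot_norm); exists 1; split=> // x; rewrite expr1n mul1r.
  - by move=> x y; rewrite -{1}(UW y) Ud.
  - by apply/funext => x /=.
  - by apply/funext => x /=.
move=> i; apply: (ext _ tf) => j; rewrite Uf.
rewrite (oe (maxn i j).+1) ?ltnS ?leq_maxl ?leq_maxr//.
by rewrite (of_ (maxn i j).+1) ?ltnS ?leq_maxl ?leq_maxr.
Qed.

End Transfer.

(** * Bounded real sequences *)

Section Sequences.
Context {R : realType}.
Implicit Types (c d : nat -> R) (k : nat).

Lemma linftyP c : linfty c <-> exists G, forall n, `|c n| <= G.
Proof.
split=> [h|[G hG]]; last first.
  apply: (@le_lt_trans _ _ G%:E); last exact: ltry.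
  by apply: ge_ereal_sup => _ [n _ <-]; rewrite lee_fin.
have ub n : (`|c n|%:E <= linfty_norm c)%E by apply: ereal_sup_ubound; exists n.
move: h; rewrite /linfty /=; case E : (linfty_norm c) => [G| |] // _.
  by exists G => n; rewrite -lee_fin -E.
by have := ub 0%N; rewrite E.
Qed.

Lemma linfty_norm_lt c (eps : R) : (linfty_norm c < eps%:E)%E -> forall n, `|c n| < eps.
Proof.
by move=> h n; rewrite -lte_fin; apply: le_lt_trans h; apply: ereal_sup_ubound; exists n.
Qed.

Lemma linfty_norm_le c (eps : R) : (forall n, `|c n| <= eps) -> (linfty_norm c <= eps%:E)%E.
Proof. by move=> h; apply: ge_ereal_sup => _ [n _ <-]; rewrite lee_fin. Qed.

Lemma linfty_bounded_fun c : linfty c -> bounded_fun (c : nat -> R^o).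
Proof.
move=> /linftyP [G hG]; exists G; split; first exact: num_real.
by move=> M GM n _; apply: le_trans (hG n) (ltW GM).
Qed.

Lemma limn_sup_le c r : linfty c ->
  (forall e, 0 < e -> exists N, forall n, (N <= n)%N -> c n <= r + e) ->
  limn_sup c <= r.
Proof.
move=> /linfty_bounded_fun bc h; apply/ler_addgt0Pr => e e0; have [N hN] := h e e0.
rewrite limn_supE//; apply: (@le_trans _ _ (sups c N)).
  by apply: ge_inf; [exact: bounded_fun_has_lbound_sups|exists N].
apply: ge_sup; first by exists (c N), N => /=.
by move=> _ [n /= Nn <-]; exact: hN.
Qed.

Lemma limn_inf_ge c r : linfty c ->
  (forall e, 0 < e -> exists N, forall n, (N <= n)%N -> r - e <= c n) ->
  r <= limn_inf c.
Proof.
move=> /linfty_bounded_fun bc h; apply/ler_addgt0Pr => e e0; have [N hN] := h e e0.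
rewrite limn_infE// -lerBlDr; apply: (@le_trans _ _ (infs c N)).
  apply: lb_le_inf; first by exists (c N), N => /=.
  by move=> _ [n /= Nn <-]; exact: hN.
by apply: ub_le_sup; [exact: bounded_fun_has_ubound_infs|exists N].
Qed.

Lemma subset_sumsN c k : subset_sums k (fun n => - c n) = -%R @` subset_sums k c.
Proof.
apply/seteqP; split=> [_ [F [Fk ->]]|_ [_ [F [Fk ->]] <-]] /=.
  by exists (\sum_(i <- F) c i); [exists F|rewrite sumrN].
by exists F; rewrite sumrN.
Qed.

Lemma L_seqE c k : L_seq k c = - U_seq k (fun n => - c n).
Proof. by rewrite /U_seq subset_sumsN. Qed.

(** Sets of k indices are handled as maps injective below k, which compose with orthonormal
    sequences. *)
Lemma subset_sums_seq c k (g : nat -> nat) :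
  (forall i j, (i < k)%N -> (j < k)%N -> g i = g j -> i = j) ->
  subset_sums k c (\sum_(i < k) c (g i)).
Proof.
move=> gi; have ug : uniq [seq g i | i <- iota 0 k].
  rewrite map_inj_in_uniq ?iota_uniq// => i j.
  by rewrite !mem_iota => /= ik jk; apply: gi.
exists [fset x in [seq g i | i <- iota 0 k]]%fset; split.
  by rewrite card_fseq undup_id// size_map size_iota.
rewrite -(big_mkord xpredT (fun i => c (g i))) /index_iota subn0 -(big_map g xpredT c).
apply: perm_big; by apply: uniq_perm => [||x] //; [exact: fset_uniq|rewrite in_fset].
Qed.

Lemma subset_sums_enum c k r : subset_sums k c r ->
  exists g, (forall i j, (i < k)%N -> (j < k)%N -> g i = g j -> i = j) /\ r = \sum_(i < k) c (g i).
Proof.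
move=> [F [Fk ->]]; exists (nth 0%N F); split.
  move=> i j ik jk /eqP; rewrite nth_uniq ?Fk// => [/eqP//|].
  exact: fset_uniq.
by rewrite (big_nth 0%N) big_mkord Fk.
Qed.

Lemma subset_sums_has_sup c k : linfty c -> has_sup (subset_sums k c).
Proof.
move=> /linftyP [G hG]; split.
  by exists (\sum_(i < k) c i); exact: (@subset_sums_seq c k id).
exists (k%:R * G) => _ /subset_sums_enum [g [_ ->]].
rewrite mulrC mulr_natr -[k in leRHS]card_ord -sumr_const; apply: ler_sum => i _.
exact: le_trans (ler_norm _) (hG _).
Qed.

End Sequences.

(** * Diagonals of the unitary orbit *)

Section Diagonals.
Context {R : realType} {H : completeNormedModType R[i]}.
Variable dot : {dot H for Num.conj}.
Implicit Types (x y z : H) (u v w f : nat -> H) (k D : nat) (c d : nat -> R).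
Local Notation sqnorm := (sqnorm dot).
Local Notation orthofam := (orthofam dot).
Local Notation oproj := (oproj dot).
Local Notation qform := (qform dot).
Hypothesis dot_norm : hilbert_norm dot.
Variable e : nat -> H.
Hypothesis be : orthonormal_basis dot e.

Let oe k : orthofam k e := @onb_orthofam _ _ dot e k be.

Lemma onb_total z : (forall i, dot z (e i) = 0) -> z = 0.
Proof. exact/expands_eq0/onb_expands. Qed.

Section Operator.
Variables (S : {linear H -> H}) (s : R).
Hypotheses (bS : bounded_by dot S s) (sS : selfadjoint dot S).

Lemma selfadjointN : selfadjoint dot (\- S).
Proof. by move=> x y; rewrite /= dotNl dotNr sS. Qed.

Lemma bounded_byN : bounded_by dot (\- S) s.
Proof. by have [s0 hs] := bS; split=> // x; rewrite /= sqnormN. Qed.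

Lemma proj_tracesN k : proj_traces dot (\- S) k = -%R @` proj_traces dot S k.
Proof.
rewrite (proj_tracesE dot_norm k be selfadjointN) (proj_tracesE dot_norm k be sS).
apply/seteqP; split=> [_ [u [ou ->]]|_ [_ [u [ou ->]] <-]] /=.
  exists (\sum_(i < k) qform S (u i)); first by exists u.
  by rewrite -sumrN; apply: eq_bigr => i _; rewrite qform_opp.
by exists u; split=> //; rewrite -sumrN; apply: eq_bigr => i _; rewrite qform_opp.
Qed.

Lemma L_opE k : L_op dot k S = - U_op dot k (\- S).
Proof. by rewrite /U_op proj_tracesN. Qed.

Lemma proj_traces_has_sup k : has_sup (proj_traces dot S k).
Proof.
rewrite (proj_tracesE dot_norm k be sS); split.
  by exists (\sum_(i < k) qform S (e i)); exists e.
exists (k%:R * s) => _ [u [ou ->]].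
rewrite mulrC mulr_natr -[k in leRHS]card_ord -sumr_const; apply: ler_sum => i _.
have := qform_le bS (u i); rewrite (orthofam_sqnorm ou)// mulr1; exact: le_trans (ler_norm _).
Qed.

Lemma U_op_ge k u : orthofam k u -> \sum_(i < k) qform S (u i) <= U_op dot k S.
Proof.
move=> ou; apply: sup_upper_bound; first exact: proj_traces_has_sup.
by rewrite (proj_tracesE dot_norm k be sS); exists u.
Qed.

Lemma U_seq_le_U_op c k : linfty c ->
  (forall eps, 0 < eps -> exists f,
    (forall k, orthofam k f) /\ forall n, `|c n - qform S (f n)| <= eps) ->
  U_seq k c <= U_op dot k S.
Proof.
move=> lc h; apply: ge_sup; first by have [] := subset_sums_has_sup k lc.
move=> _ /subset_sums_enum [g [gi ->]]; apply/ler_addgt0Pr => eps e0.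
(* Dividing by k + 1 covers k = 0 as well. *)
have k0 : 0 < k.+1%:R :> R by rewrite ltr0n.
have [f [of_ hf]] := h _ (divr_gt0 e0 k0).
have ofg : orthofam k (f \o g).
  move=> i j ik jk /=; rewrite (of_ (maxn (g i) (g j)).+1) ?ltnS ?leq_maxl ?leq_maxr//.
  by congr (nat_of_bool _)%:R; apply/eqP/eqP => [|->//]; exact: gi.
apply: le_trans (lerD (U_op_ge ofg) (lexx _)).
apply: (@le_trans _ _ (\sum_(i < k) (qform S (f (g i)) + eps / k.+1%:R))).
  apply: ler_sum => i _; rewrite -lerBlDl; apply: le_trans (hf (g i)); exact: ler_norm.
rewrite big_split /= lerD2l sumr_const card_ord -[leLHS]mulr_natr mulrAC ler_pdivrMr//.
by apply: ler_wpM2l; [exact: ltW|rewrite ler_nat].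
Qed.

Lemma submajorizedI c : linfty c -> (forall k, (0 < k)%N -> U_seq k c <= U_op dot k S) ->
  submajorized dot c S.
Proof.
move=> lc hU [|k] g eps e0 gi; first by exists (fun=> 0); split; rewrite ?big_ord0 ?add0r ?(ltW e0).
have [r tr h] := sup_adherent e0 (proj_traces_has_sup k.+1).
move: tr; rewrite (proj_tracesE dot_norm k.+1 be sS) => -[u [ou rE]]; subst r.
exists u; split=> //; have := hU k.+1 isT.
have : \sum_(i < k.+1) c (g i) <= U_seq k.+1 c.
  apply: sup_upper_bound; [exact: subset_sums_has_sup|exact: subset_sums_seq].
move: h; rewrite -/(U_op dot k.+1 S).
by move: (\sum_(i < _) qform S _) (\sum_(i < _) c _) (U_seq _ _) (U_op _ _ _) => *; lra.
Qed.

Lemma closure_approx c : linfty_closure (orbit_diagonals dot e S) c -> forall eps : R, 0 < eps ->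
  exists f, (forall k, orthofam k f) /\ forall n, `|c n - qform S (f n)| <= eps.
Proof.
move=> [_ h] eps e0; have [d [[T [[U [W [[bU bW UW WU _] ->]]] dE]] _ hd]] := h eps e0.
exists (U \o e); split.
  move=> k i j ik jk /=; rewrite UW -[W (U _)]/((W \o U) _) WU; exact: oe jk.
move=> n; apply: ltW; have := linfty_norm_lt hd n; rewrite /=.
have -> // : d n = qform S (U (e n)).
rewrite /qform; have := dE n => /= h1.
have UW' : is_adjoint dot W U.
  by move=> x y; rewrite dotC -UW -dotC.
by rewrite UW' in h1; rewrite -h1.
Qed.

(** Totality makes f a basis, so a unitary carries e to f and the diagonal of S along f belongs to
    the orbit. *)
Lemma approx_closure c : linfty c -> (forall eps : R, 0 < eps ->
  exists f, [/\ forall k, orthofam k f, forall z, (forall i, dot z (f i) = 0) -> z = 0 &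
    forall n, `|qform S (f n) - c n| <= eps]) ->
  linfty_closure (orbit_diagonals dot e S) c.
Proof.
move=> lc h; split=> // eps e0; have e2 : 0 < eps / 2 by rewrite divr_gt0.
have [f [of_ tf hf]] := h _ e2.
have [U [W [UW Ue]]] := unitary_transfer dot_norm oe of_ onb_total tf.
exists (fun n => qform S (f n)); split.
- exists (W \o S \o U); split; first by exists U, W.
  move=> n /=; rewrite Ue -selfadj_real//; case: UW => _ _ adj _ _.
  by rewrite [RHS]dotC -adj Ue -dotC.
- apply/linftyP; exists s => n; have := qform_le bS (f n).
  by rewrite (orthofam_sqnorm (of_ n.+1))// mulr1.
- apply: (@le_lt_trans _ _ (eps / 2)%:E); last by rewrite lte_fin ltr_pdivrMr// ltr_pMr// ltr1n.
  by apply: linfty_norm_le => n /=; rewrite distrC.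
Qed.
End Operator.

Section Equivalence.
Variables (S : {linear H -> H}) (s : R).
Hypotheses (bS : bounded_by dot S s) (sS : selfadjoint dot S).
Variable c : nat -> R.
Hypothesis lc : linfty c.
Local Notation ess := (ess dot).

Lemma linftyN : linfty (fun n => - c n).
Proof.
move/linftyP: lc => [G hG]; apply/linftyP; exists G => n; by rewrite normrN.
Qed.

Lemma closure_U_seq_le k : linfty_closure (orbit_diagonals dot e S) c ->
  U_seq k c <= U_op dot k S /\ U_seq k (fun n => - c n) <= U_op dot k (\- S).
Proof.
move=> cc; have h := closure_approx cc; split; first exact: (U_seq_le_U_op bS sS).
apply: (@U_seq_le_U_op (\- S) s (bounded_byN bS) (selfadjointN sS) _ k linftyN) => eps e0.
have [f [of_ hf]] := h eps e0.
by exists f; split=> // n; rewrite qform_opp -opprB opprK normrN addrC.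
Qed.

Lemma majorized_closure : submajorized dot c S -> submajorized dot (fun n => - c n) (\- S) ->
  linfty_closure (orbit_diagonals dot e S) c.
Proof.
(* The third of eps, since [diagonal_extension] triples its parameter. *)
move=> m1 m2; apply: (approx_closure bS sS lc) => eps e0; pose d := eps / 3.
have d0 : 0 < d by rewrite divr_gt0.
have [N1 h1] : exists N, forall n, (N <= n)%N -> c n <= ess S + d.
  by apply: (submajorized_tail oe bS sS m1); rewrite ltrDl.
have [N2 h2] : exists N, forall n, (N <= n)%N -> - c n <= ess (\- S) + d.
  by apply: (submajorized_tail oe (bounded_byN bS) (selfadjointN sS) m2); rewrite ltrDl.
have [f0 [of0 hf0]] := finite_diagonal oe sS (maxn N1 N2) e0 m1 m2.
move/linftyP: lc => hG.
have [n|f [of_ f_0 hf ha]] := diagonal_extension oe bS sS d0 of0 hG.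
  rewrite geq_max => /andP[nN1 nN2]; split; last exact: h1.
  by have := h2 n nN2; move: (ess _) => m; lra.
exists f; split=> // [|n].
  exact: (total_of_approx of_ onb_total ha).
have [nN|nN] := ltnP n (maxn N1 N2); first by rewrite f_0// hf0.
by apply: le_trans (hf n nN) _; rewrite /d mulrC divfK.
Qed.

Lemma ess_ge_limsup : submajorized dot c S -> limn_sup c <= ess S.
Proof.
move=> m1; apply: limn_sup_le => // d d0.
by apply: (submajorized_tail oe bS sS m1); rewrite ltrDl.
Qed.

Lemma ess_le_liminf : submajorized dot (fun n => - c n) (\- S) -> - ess (\- S) <= limn_inf c.
Proof.
move=> m2; apply: limn_inf_ge => // d d0.
have [N hN] : exists N, forall n, (N <= n)%N -> - c n <= ess (\- S) + d.
  by apply: (submajorized_tail oe (bounded_byN bS) (selfadjointN sS) m2); rewrite ltrDl.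
by exists N => n /hN; move: (ess _) => m; lra.
Qed.
End Equivalence.
End Diagonals.

Theorem theorem3p10 (R : realType) (H : completeNormedModType R[i])
    (dot : {dot H for Num.conj}) (dot_norm : hilbert_norm dot)
    (H_sep : separable_space H) (H_inf : @infinite_dim R H)
    (e : nat -> H) (e_basis : orthonormal_basis dot e)
    (S : {linear H -> H}) (S_bounded : bounded_op S)
    (S_selfadj : selfadjoint dot S)
    (c : nat -> R) (c_bounded : linfty c) :
  (linfty_closure (orbit_diagonals dot e S) c <->
   (forall k : nat, (0 < k)%N ->
      U_op dot k S >= U_seq k c /\ L_op dot k S <= L_seq k c)) /\
  (linfty_closure (orbit_diagonals dot e S) c ->
   (exists M : R, is_max (ess_spectrum S) M /\ M >= limn_sup c) /\
   (exists m : R, is_min (ess_spectrum S) m /\ m <= limn_inf c)).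
Proof.
have [s bS] := bounded_byP dot_norm S_bounded.
have [bNS sNS] := (bounded_byN bS, selfadjointN S_selfadj).
have oe k : orthofam dot k e := @onb_orthofam _ _ dot e k e_basis.
(* The conditions on L_k become conditions on U_k for -S and -c, so each upper statement is used
   twice. *)
have LE k : (L_op dot k S <= L_seq k c) = (U_seq k (fun n => - c n) <= U_op dot k (\- S)).
  by rewrite (L_opE dot_norm e_basis S_selfadj) L_seqE lerN2.
have toU : linfty_closure (orbit_diagonals dot e S) c ->
    forall k, U_seq k c <= U_op dot k S /\ L_op dot k S <= L_seq k c.
  by move=> cc k; rewrite LE; exact: (closure_U_seq_le dot_norm e_basis bS).
have toM : (forall k, (0 < k)%N -> U_op dot k S >= U_seq k c /\ L_op dot k S <= L_seq k c) ->
    submajorized dot c S /\ submajorized dot (fun n => - c n) (\- S).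
  move=> hU; split.
    by apply: (submajorizedI dot_norm e_basis bS) => // k /hU [].
  apply: (submajorizedI dot_norm e_basis bNS sNS (linftyN c_bounded)) => k /hU [_].
  by rewrite LE.
split; first split=> [/toU h k _|/toM [m1 m2]]; first exact: h.
  exact: (majorized_closure dot_norm e_basis bS).
move=> /toU h; have [m1 m2] := toM (fun k _ => h k); split.
  exists (ess dot S); split; first exact: (ess_is_max dot_norm oe bS S_selfadj).
  exact: (ess_ge_limsup e_basis bS).
exists (- ess dot (\- S)); split.
  exact/is_max_min/(ess_is_max dot_norm oe bNS sNS).
exact: (ess_le_liminf e_basis bS).
Qed.
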